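(* Let $p\in(1,\infty)$, $p'=p/(p-1)$, and $f\in L_{p'}$. Then there exist selections of the conditional expectations such that $$\mathcal L^*(f)(t,\omega)=\mathbf M\left\{\left.\int_t^1 f(s,\omega)\,ds\ \right|\ \mathfrak F_t\right\}.$$ More precisely: (selections for which the right-hand side is $\mathfrak{BF}$-measurable in $(t,\omega)$ exist, and) all $\mathfrak{BF}$-measurable functions given by the right-hand side belong to the equivalence class $\mathcal L^*(f)$.
   Context: $(\Omega,\mathfrak F,\mathbf P)$ is a complete probability space, $\mathbf M$ denotes expectation, $\{\mathfrak F_t,\ t\in[0,1]\}$ is a right-continuous filtration of sub-$\sigma$-fields of $\mathfrak F$, and $\mathfrak{BF}$ is the $\sigma$-field of subsets of $[0,1]\times\Omega$ progressively measurable with respect to $\{\mathfrak F_t\}$. $L_p$ is the Banach space of (classes, modulo $\mathrm{mes}\times\mathbf P$, where $\mathrm{mes}$ is Lebesgue measure, of) $\mathfrak{BF}$-measurable functions with norm $\|f\|_p=\{\mathbf M\int_0^1|f(t,\omega)|^pdt\}^{1/p}$. $CH_p$ is the normed space of (classes of indistinguishable) $\mathfrak{BF}$-measurable functions with a.s. continuous trajectories and finite norm $|f|^{(d)}_p=\{\mathbf M\sup_{0\le t\le1}|f(t,\omega)|^p\}^{1/p}$. $\mathcal L:L_p\to CH_p$ is the bounded linear operator $\mathcal L(f)(t,\omega)=\int_0^tf(s,\omega)\,ds$, and $\mathcal L^*:(CH_p)^*\to L_p^*$ is its conjugate (adjoint). $L_p^*$ is identified with $L_{p'}$ via $h\leftrightarrow\left(\varphi\mapsto\mathbf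 M\int_0^1h\varphi\,ds\right)$. Since $CH_p\subset L_p$, each $f\in L_{p'}$ is regarded as the element $g\mapsto\mathbf M\int_0^1fg\,ds$ of $(CH_p)^*$. Thus $\mathcal L^*(f)\in L_{p'}$ is determined by $\mathbf M\int_0^1 f\,\mathcal L(\varphi)\,ds=\mathbf M\int_0^1\mathcal L^*(f)\,\varphi\,ds$ for all $\varphi\in L_p$. *)

(* Defs.v *)
From HB Require Import structures.
From mathcomp Require Import all_boot all_order all_algebra.
From mathcomp Require Import all_classical all_reals all_analysis.
From mathcomp Require Import measurable_realfun.

Set Implicit Arguments.
Unset Strict Implicit.
Unset Printing Implicit Defensive.

Import Order.TTheory GRing.Theory Num.Theory.
Import numFieldNormedType.Exports.

Local Open Scope classical_set_scope.
Local Open Scope ring_scope.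

Record filtration (d : measure_display) (Omega : measurableType d)
    (R : realType) := Filtration {
  Ft :> R -> set (set Omega) ;
  Ft_sigma_algebra : forall t, 0 <= t <= 1 -> sigma_algebra setT (Ft t) ;
  Ft_measurable : forall t, 0 <= t <= 1 -> Ft t `<=` measurable ;
  Ft_nondecreasing : forall s t, 0 <= s -> s <= t -> t <= 1 -> Ft s `<=` Ft t ;
  Ft_right_continuous : forall t, 0 <= t < 1 ->
    Ft t = \bigcap_(s in `]t, 1]) Ft s }.

Section spaces.
Context {d : measure_display} {Omega : measurableType d} {R : realType}.
Variables (P : probability Omega R) (F : filtration Omega R).
Local Notation mes := (@lebesgue_measure R).

(* Functions on [0,1] x Omega are given by total functions on R x Omega whose
   values at times outside [0,1] are irrelevant. Elements of L_p and CH_p are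
   given by representatives of their classes. *)
Local Notation process := (R * Omega -> R)%type.

(* B(R) (x) F_t; its trace on [0,t] x Omega is B([0,t]) (x) F_t. *)
Definition prog_prod (t : R) : set (set (R * Omega)) :=
  @measurable _ (measurableTypeR R * g_sigma_algebraType (F t))%type.

Definition BF : set (set (R * Omega)) :=
  [set A | A `<=` `[0, 1] `*` setT /\
    forall t, 0 <= t <= 1 -> prog_prod t (A `&` (`[0, t] `*` setT))].

Definition BF_measurable (f : process) : Prop :=
  forall B : set R, measurable B -> BF ((`[0, 1] `*` setT) `&` f @^-1` B).

Definition Lp_norm (p : R) (f : process) : \bar R :=
  ((\int[P]_w \int[mes]_(t in `[0%R, 1%R]) (`|f (t, w)| `^ p)%:E) `^ p^-1)%E.

Definition in_Lp (p : R) (f : process) : Prop :=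
  BF_measurable f /\ (Lp_norm p f < +oo)%E.

(* For a.s. continuous g and complete P the supremum is measurable, so this is
   the usual expectation. *)
Definition CH_norm (p : R) (g : process) : \bar R :=
  ((\int[P]_w ereal_sup [set (`|g (t, w)| `^ p)%:E | t in `[0%R, 1%R]])
     `^ p^-1)%E.

Definition in_CH (p : R) (g : process) : Prop :=
  [/\ BF_measurable g,
      {ae P, forall w, {within `[0, 1], continuous (fun t => g (t, w))}} &
      (CH_norm p g < +oo)%E].

Definition Lp (p : R) : Type := {f : process | in_Lp p f}.
Definition CH (p : R) : Type := {g : process | in_CH p g}.

Definition int0 (f : process) : process :=
  fun x => \int[mes]_(s in `[0, x.1]) f (s, x.2).
End spaces.

Section int0_CH.
Context {d : measure_display} {Omega : measurableType d} {R : realType}.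
Variables (P : probability Omega R) (F : filtration Omega R).
Local Notation mes := (@lebesgue_measure R).
Local Notation process := (R * Omega -> R)%type.
Local Notation gT t := (g_sigma_algebraType (F t)).

Lemma BF_measurableP (f : process) : BF_measurable F f <->
  forall t, 0 <= t <= 1 -> @measurable_fun _ _ (measurableTypeR R * gT t)%type
    (measurableTypeR R) (`[0, t] `*` setT) f.
Proof.
have sub (t : R) : 0 <= t <= 1 ->
    (`[0, t] `*` [set: Omega]) `<=` (`[0, 1] `*` [set: Omega]).
  move=> /andP[t0 t1] [s w] /= [+ _]; rewrite !in_itv/= => /andP[-> st].
  by split => //; exact: le_trans st t1.
split=> [mf t t01 _ B mB | mf B mB].
  have [_ /(_ t t01)] := mf B mB.
  rewrite /prog_prod setIAC (setIidr (sub t t01)) => h.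
  exact: h.
split=> [x [] // | t t01].
rewrite /prog_prod setIAC (setIidr (sub t t01)).
apply: (mf t t01) => //.
by apply: measurableX => //; exact: measurable_itv.
Qed.

Lemma int0_BF f : BF_measurable F f -> BF_measurable F (int0 f).
Proof.
move=> /BF_measurableP mf; apply/BF_measurableP => T T01.
pose D : set (measurableTypeR R * gT T) := `[0, T] `*` setT.
have mD : measurable D by apply: measurableX => //; exact: measurable_itv.
have mfD : @measurable_fun _ _ (measurableTypeR R * gT T)%type
    (measurableTypeR R) setT (f \_ D).
  have := mf T T01; by rewrite (measurable_restrictT _ mD).
pose XR := (measurableTypeR R * gT T)%type.
pose E : set (XR * measurableTypeR R) :=
  [set x | 0 <= x.2] `&` [set x | x.2 <= x.1.1].
have mfst : measurable_fun setT (fun x : XR * measurableTypeR R => x.1.1).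
  exact: measurableT_comp measurable_fst measurable_fst.
have msnd : measurable_fun setT (fun x : XR * measurableTypeR R => x.2).
  exact: measurable_snd.
have mE : measurable E.
  have := @measurable_fun_le _ (XR * measurableTypeR R)%type R setT
    (cst 0) snd measurableT (@measurable_cst _ _ _ _ _ _) msnd.
  have := @measurable_fun_le _ (XR * measurableTypeR R)%type R setT
    snd (fun x => x.1.1) measurableT msnd mfst.
  by rewrite !setTI => mE2 mE1; exact: measurableI.
pose psi : XR * measurableTypeR R -> \bar R :=
  fun x => ((f \_ D) (x.2, x.1.2) * \1_E x)%:E.
have mpsi : measurable_fun setT psi.
  apply/measurable_EFinP; apply: measurable_funM.
    apply: (measurableT_comp mfD).
    apply: measurable_fun_pair => //.
    exact: measurableT_comp measurable_snd measurable_fst.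
  exact: measurable_indic.
have mF : measurable_fun setT (fun x : XR => \int[mes]_s psi (x, s))%E.
  have mp : measurable_fun setT (fubini_F mes psi^\+%E).
    apply: measurable_fun_fubini_tonelli_F; first exact: measurable_funepos.
    by move=> x; rewrite funepos_ge0.
  have mn : measurable_fun setT (fubini_F mes psi^\-%E).
    apply: measurable_fun_fubini_tonelli_F; first exact: measurable_funeneg.
    by move=> x; rewrite funeneg_ge0.
  rewrite [X in measurable_fun _ X](_ : _ =
      (fubini_F mes psi^\+ \- fubini_F mes psi^\-)%E).
    exact: emeasurable_funB.
  by apply/funext => x; rewrite integralE; congr (_ - _)%E; apply: eq_integral => s _; rewrite ?funeposE ?funenegE.
have : measurable_fun (D : set XR) (fun x => fine (\int[mes]_s psi (x, s))%E).
  apply: measurable_funTS.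
  by apply: (measurableT_comp _ mF).
apply: eq_measurable_fun => -[u w] /set_mem [/= + _].
rewrite in_itv/= => /andP[u0 uT].
rewrite /int0 /Rintegral/= [in RHS]integral_mkcond; congr fine.
apply: eq_integral => s _; rewrite /psi /patch/=.
rewrite indicE /D /E.
have [sA|sA] := boolP (s \in `[0, u]).
  have /andP[s0 su] : 0 <= s <= u by move: sA; rewrite in_itv.
  rewrite !mem_set/= ?mulr1//; split => //.
  by rewrite /= in_itv/= s0/= (le_trans su).
rewrite [X in _ * (X%:R)](_ : _ = 0%N); last first.
  apply/eqP; rewrite eqb0; apply/negP => /set_mem [/= s0 su].
  by move/negP: sA; apply; rewrite in_itv/= s0.
rewrite mulr0 ifF//; apply/negbTE/negP => /set_mem/=.
by apply/negP.
Qed.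

Lemma powR_integral_le (p : R) (u : R -> R) : 1 < p ->
  measurable_fun (`[0, 1] : set (measurableTypeR R)) u ->
  ((\int[mes]_(s in `[0%R, 1%R]) `|u s|%:E) `^ p <=
   \int[mes]_(s in `[0%R, 1%R]) (`|u s| `^ p)%:E)%E.
Proof.
move=> p1 mu.
have p0 : 0 < p by exact: lt_trans p1.
have q0 : 0 < p / (p - 1) by rewrite divr_gt0// subr_gt0.
have pq : p^-1 + (p / (p - 1))^-1 = 1.
  by rewrite invf_div mulrBl divff ?gt_eqF// mul1r addrCA subrr addr0.
pose I : set (measurableTypeR R) := [set` `[0, 1]].
have mI : measurable I by exact: measurable_itv.
have mh : measurable_fun setT (u \_ I) by have := mu; rewrite (measurable_restrictT _ mI).
have mi : measurable_fun setT (\1_I : R -> R) by exact: measurable_indic.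
have := @hoelder _ _ _ mes _ _ _ _ mh mi p0 q0 pq.
have -> : ('N[mes]_1[EFin \o (u \_ I \* \1_I)%R] =
    \int[mes]_(s in `[0%R, 1%R]) `|u s|%:E)%E.
  rewrite Lnorm1 [RHS]integral_mkcond; apply: eq_integral => s _ /=.
  rewrite /patch indicE.
  by case: ifPn => _; rewrite ?mulr1 ?mulr0// normr0.
have -> : ('N[mes]_p%:E[EFin \o (u \_ I)] =
    (\int[mes]_(s in `[0%R, 1%R]) (`|u s| `^ p)%:E) `^ p^-1)%E.
  rewrite unlock [in RHS]integral_mkcond; congr poweR.
  apply: eq_integral => s _ /=.
  rewrite /patch.
  by case: ifPn => _ //; rewrite normr0 powR0// gt_eqF.
have -> : 'N[mes]_((p / (p - 1))%:E)[EFin \o (\1_I : R -> R)]%E = 1%E.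
  rewrite unlock (_ : (\int[mes]_x _)%E = (\int[mes]_(x in I) 1)%E); last first.
    rewrite [in RHS]integral_mkcond; apply: eq_integral => s _ /=.
    rewrite /patch indicE.
    by case: ifPn => _ //=; rewrite ?normr1 ?powR1// normr0 powR0// gt_eqF.
  have mI1 : mes [set` `[0, 1]] = 1%E.
    by rewrite lebesgue_measure_itv/= lte01 sube0.
  by rewrite integral_cst// mul1e (_ : _ I = 1%E)// poweR1r.
rewrite mule1 => h.
have := @gt0_ler_poweR R p (ltW p0) _ _ _ _ h.
rewrite -poweRrM mulVf ?gt_eqF// poweRe1; last first.
  by apply: integral_ge0 => s _; rewrite lee_fin powR_ge0.
apply; rewrite in_itv/= leey andbT.
- by apply: integral_ge0 => s _; rewrite lee_fin.
- by rewrite poweR_ge0.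
Qed.

Lemma BF_measurable_joint f : BF_measurable F f ->
  @measurable_fun _ _ (measurableTypeR R * Omega)%type (measurableTypeR R)
    setT (f \_ (`[0, 1] `*` setT)).
Proof.
have c01 : 0 <= (1 : R) <= 1 by rewrite ler01 lexx.
move=> /BF_measurableP /(_ _ c01) mf.
pose D : set (measurableTypeR R * gT 1) := `[0, 1] `*` setT.
have mD : measurable D by apply: measurableX => //; exact: measurable_itv.
have mfD : @measurable_fun _ _ (measurableTypeR R * gT 1)%type
    (measurableTypeR R) setT (f \_ D).
  by have := mf; rewrite (measurable_restrictT _ mD).
have mid : @measurable_fun _ _ (measurableTypeR R * Omega)%type
    (measurableTypeR R * gT 1)%type setT (fun x => (x.1, x.2)).
  apply: measurable_fun_pair; first exact: measurable_fst.
  move=> _ B mB; rewrite setTI -[_ @^-1` _]setTX.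
  apply: measurableX => //.
  apply: (smallest_sub _ _ mB); last exact: (@Ft_measurable _ _ _ F 1 c01).
  split=> //; first by move=> A mA; apply: measurableD.
  by move=> A mA; exact: bigcupT_measurable.
have := measurableT_comp mfD mid.
by apply: eq_measurable_fun => -[].
Qed.

Lemma le_integral_nomeas d' (T : measurableType d')
    (m : {measure set T -> \bar R}) (u v : T -> \bar R) :
  (forall x, (0 <= u x)%E) -> (forall x, (u x <= v x)%E) ->
  (\int[m]_x u x <= \int[m]_x v x)%E.
Proof.
move=> u0 uv.
have v0 x : (0 <= v x)%E by exact: le_trans (uv x).
rewrite !ge0_integralTE//; apply: ereal_sup_le => _ [h hu <-].
by exists h => // x; exact: le_trans (hu x) (uv x).
Qed.

Lemma section_measurable f w : BF_measurable F f ->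
  measurable_fun (`[0, 1] : set (measurableTypeR R)) (fun s => f (s, w)).
Proof.
move=> /BF_measurable_joint mf.
have mI : measurable (`[0, 1] : set (measurableTypeR R)).
  exact: measurable_itv.
rewrite (measurable_restrictT _ mI).
have := @measurable_fun_pair1 _ _ _ _ _ _ _ w mf.
apply: eq_measurable_fun => s _; rewrite /patch.
by congr (if _ then _ else _); apply/idP/idP => /set_mem; rewrite ?inE//= => -[].
Qed.

Lemma section_integrable p f w : 1 < p -> BF_measurable F f ->
  (\int[mes]_(t in `[0%R, 1%R]) (`|f (t, w)| `^ p)%:E < +oo)%E ->
  mes.-integrable `[0, 1] (EFin \o (fun s => f (s, w))).
Proof.
move=> p1 mf foo; apply/integrableP; split.
  by apply/measurable_EFinP; exact: section_measurable.
have := le_lt_trans (powR_integral_le p1 (section_measurable w mf)) foo.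
by apply: lty_poweRy; rewrite gt_eqF// (lt_trans _ p1).
Qed.

Lemma int0_powR_le p f t w : 1 < p -> BF_measurable F f -> 0 <= t <= 1 ->
  ((`|int0 f (t, w)| `^ p)%:E <=
   \int[mes]_(s in `[0%R, 1%R]) (`|f (s, w)| `^ p)%:E)%E.
Proof.
move=> p1 mf /andP[t0 t1].
have p0 : 0 <= p by rewrite (le_trans _ (ltW p1)).
have [foo|] := ltP (\int[mes]_(s in `[0%R, 1%R]) (`|f (s, w)| `^ p)%:E)%E +oo%E;
  last by rewrite leye_eq => /eqP ->; rewrite leey.
apply: le_trans (powR_integral_le p1 (section_measurable w mf)).
have intf := section_integrable p1 mf foo.
have sub : `[0, t] `<=` `[0, 1].
  by apply: subset_itvl; rewrite bnd_simp.
have intt : mes.-integrable `[0, t] (EFin \o (fun s => f (s, w))).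
  by apply: integrableS intf => //; exact: measurable_itv.
rewrite -poweR_EFin; apply: gt0_ler_poweR => //.
- by rewrite in_itv/= lee_fin normr_ge0 leey.
- rewrite in_itv/= leey andbT; apply: integral_ge0 => s _.
  by rewrite lee_fin.
rewrite /int0/= (EFin_normr_Rintegral _ intt)//.
apply: le_trans (le_abse_integral _ _ _) _ => //.
  by case/integrableP: intt.
apply: ge0_subset_integral => //.
by case/integrableP: intf => + _; exact: measurableT_comp.
Qed.

Lemma int0_CH p f : 1 < p -> in_Lp P F p f -> in_CH P F p (int0 f).
Proof.
move=> p1 [mf foo].
have p0 : 0 < p by rewrite (lt_trans _ p1).
pose G w := (\int[mes]_(t in `[0%R, 1%R]) (`|f (t, w)| `^ p)%:E)%E.
have G0 w : (0 <= G w)%E.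
  by apply: integral_ge0 => t _; rewrite lee_fin powR_ge0.
have Goo : (\int[P]_w G w < +oo)%E.
  by move: foo; apply: lty_poweRy; rewrite gt_eqF// invr_gt0.
split; first exact: int0_BF.
  have mG : measurable_fun setT G.
    have mh : measurable_fun setT (fun x : measurableTypeR R * Omega =>
        (`|(f \_ (`[0, 1] `*` setT)) x| `^ p)%:E).
      apply/measurable_EFinP.
      apply: (@measurableT_comp _ _ _ _ _ _ (@powR R ^~ p)) => //.
      by apply: measurableT_comp => //; exact: BF_measurable_joint.
    have := @measurable_fun_fubini_tonelli_G _ _ _ _ _ mes _ mh.
    have h0 : forall x : R * Omega,
        (0 <= (`|(f \_ (`[0, 1] `*` setT)) x| `^ p)%:E)%E.
      by move=> x; rewrite lee_fin powR_ge0.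
    move=> /(_ h0); apply: eq_measurable_fun => w _.
    rewrite /fubini_G /G [in RHS]integral_mkcond.
    apply: eq_integral => s _; rewrite /patch /=.
    rewrite in_setX in_setT andbT.
    by case: ifPn => // _; rewrite normr0 powR0// gt_eqF.
  have iG : P.-integrable setT G.
    apply/integrableP; split => //.
    by under eq_integral do rewrite gee0_abs//.
  apply: filterS (integrable_ae measurableT iG) => w /(_ Logic.I) Gw.
  have Gwoo : (G w < +oo)%E by rewrite -ge0_fin_numE.
  have := parameterized_integral_continuous ler01
    (section_integrable p1 mf Gwoo).
  exact.
rewrite /CH_norm; apply: poweR_lty; apply: le_lt_trans Goo.
have sup_ge0 w : (0 <= ereal_sup [set (`|int0 f (t, w)| `^ p)%:E |
    t in `[0%R, 1%R]])%E.
  apply: le_trans (ereal_sup_ubound _); last first.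
    by exists 0 => //=; rewrite in_itv/= lexx ler01.
  by rewrite lee_fin powR_ge0.
apply: le_integral_nomeas => // w.
apply: ge_ereal_sup => _ [t /= + <-]; rewrite in_itv/= => t01.
exact: int0_powR_le.
Qed.
End int0_CH.

Section adjoint.
Context {d : measure_display} {Omega : measurableType d} {R : realType}.
Variables (P : probability Omega R) (F : filtration Omega R).
Local Notation mes := (@lebesgue_measure R).
Local Notation process := (R * Omega -> R)%type.

Definition Lop (p : R) (p1 : 1 < p) (phi : Lp P F p) : CH P F p :=
  exist _ (int0 (sval phi)) (int0_CH p1 (svalP phi)).

Definition pairing (f g : process) : R :=
  \int[P]_w \int[mes]_(s in `[0, 1]) (f (s, w) * g (s, w)).

Definition Lp_functional (p : R) (h : process) : Lp P F p -> R :=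
  fun phi => pairing h (sval phi).

Definition CH_functional (p : R) (f : process) : CH P F p -> R :=
  fun g => pairing f (sval g).

Definition Lop_adjoint (p : R) (p1 : 1 < p) (Phi : CH P F p -> R) :
    Lp P F p -> R :=
  fun phi => Phi (Lop p1 phi).

(* The equivalence class L^*(f), i.e. the set of its representatives: those
   elements of L_{p'} whose functional on L_p is the image under the adjoint of
   the functional of f on CH_p. *)
Definition Lstar (p : R) (p1 : 1 < p) (f : Lp P F (p / (p - 1))) :
    set process :=
  [set h | in_Lp P F (p / (p - 1)) h /\
    forall phi : Lp P F p,
      Lp_functional h phi = Lop_adjoint p1 (CH_functional (sval f)) phi].

(* Y is a version of the conditional expectation of X given the sigma-field G *)
Definition is_cond_exp (G : set (set Omega)) (X Y : Omega -> R) : Prop :=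
  [/\ P.-integrable setT (EFin \o X), P.-integrable setT (EFin \o Y),
      (forall B : set R, measurable B -> G (Y @^-1` B)) &
      (forall A, G A -> \int[P]_(w in A) Y w = \int[P]_(w in A) X w)].

Definition is_selection (f g : process) : Prop :=
  forall t, 0 <= t <= 1 ->
    is_cond_exp (F t) (fun w => \int[mes]_(s in `[t, 1]) f (s, w))
      (fun w => g (t, w)).
End adjoint.

(* Main.v *)
Require Import Defs.
From HB Require Import structures.
From mathcomp Require Import all_boot all_order all_algebra.
From mathcomp Require Import all_classical all_reals all_analysis.
From mathcomp Require Import measurable_realfun ring lra.
Import Order.TTheory GRing.Theory Num.Theory.
Import numFieldNormedType.Exports.
Local Open Scope classical_set_scope.
Local Open Scope ring_scope.

Set Implicit Arguments.
Unset Strict Implicit.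
Unset Printing Implicit Defensive.

(* Write X_t for the integral of f over [t, 1]. Since X_t = X_0 - int0 f t
   almost surely, a selection is a progressively measurable version of the
   martingale M_t = E[X_0 | F_t], minus int0 f. The filtration is not completed
   and no path regularity of M is available, so the version is built as the
   limsup over k of M_(rho_k(t)), where rho_k is a Borel function with countably
   many values, t < rho_k(t) <= t + 2^-(k+1), and M_(rho_k(t)) is at L^1-distance
   at most 2^-(k+1) from every M_s with t < s <= rho_k(t). Such times exist
   because s |-> M_s is L^1-Cauchy as s decreases to t: for square integrable X_0
   the L^2-distances are increments of the monotone function E[M_s^2], and the
   general case follows by truncation. The increments being summable in L^1, the
   sequence converges almost surely and in L^1 for each t, and right continuity
   of the filtration identifies the limit with E[X_0 | F_t].

   Conversely, let g be a measurable selection. For each t, |g_t|^q has a smaller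
   expectation than |X_t|^q, whence g is in L_q. For phi in L_p, Fubini's theorem
   on the triangle u <= s and then on [0, 1] x Omega gives
   E int f int0(phi) ds = int E[phi_u X_u] du = int E[phi_u g_u] du, because phi_u
   is F_u-measurable. *)

(** * Limit superior, and the inner integral of the layer cake formula *)

Lemma limn_esup_near_eq (R : realType) (u v : (\bar R)^nat) :
  (\forall n \near \oo, u n = v n) -> limn_esup u = limn_esup v.
Proof.
suff le (a b : (\bar R)^nat) : (\forall n \near \oo, a n = b n) ->
    (limn_esup a <= limn_esup b)%E.
  move=> uv; apply/eqP; rewrite eq_le le//= le//.
  by apply: filterS uv => n ->.
move=> ab; apply: le_ereal_inf_tmp => _ [V FV <-].
(* Shrinking [V] to the indices of agreement stays in the filter and can only lower the supremum. *)
pose W := V `&` [set n | a n = b n].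
have FW : \oo W by exact: filterI.
apply: (@le_trans _ _ (ereal_sup (a @` W))).
  by apply: ereal_inf_lbound; exists W.
apply: ereal_sup_le => _ [n [Vn abn] <-]; by exists n.
Qed.

Lemma integral_mul_itv_indic (R : realType) (c u : R) : 0 <= u ->
  (\int[lebesgue_measure]_t (c * \1_`[0%R, u] t)%:E = (c * u)%:E)%E.
Proof.
move=> u0; under eq_integral do rewrite EFinM.
rewrite integralZl//; last exact: integrable_indic_itv.
rewrite integral_indic// setIT EFinM; congr (_ * _)%E.
rewrite [LHS]lebesgue_measure_itv/= lte_fin.
by case: ltP => [_|u0']; rewrite ?sube0// (@le_anti _ _ u 0)// u0 u0'.
Qed.

(** * Integrable real functions *)

Section integrable_fun.
Context {d : measure_display} {T : measurableType d} {R : realType}.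
Variable mu : {measure set T -> \bar R}.

Lemma integrable_EFinB (U V : T -> R) : mu.-integrable setT (EFin \o U) ->
  mu.-integrable setT (EFin \o V) -> mu.-integrable setT (EFin \o (U \- V)).
Proof.
move=> iU iV; rewrite (_ : _ \o _ = (EFin \o U) \- (EFin \o V))%E//.
exact: integrableB.
Qed.

Lemma integrable_bounded_mul (X U : T -> R) (c : R) :
  measurable_fun setT U -> (forall w, `|U w| <= c) ->
  mu.-integrable setT (EFin \o X) -> mu.-integrable setT (EFin \o (U \* X)).
Proof.
move=> mU Uc iX.
have mX : measurable_fun setT X by apply/measurable_EFinP; exact: measurable_int iX.
apply: (@le_integrable _ _ _ _ _ _ _ (fun w => c%:E * (X w)%:E)%E) => //;
  last exact: integrableZl.
  by apply/measurable_EFinP; exact: measurable_funM.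
move=> w _; rewrite /= !lee_fin !normrM ler_wpM2r// (le_trans (Uc w))//.
by rewrite ler_norm.
Qed.

Lemma integrable_mul_sqr (X Y : T -> R) :
  measurable_fun setT X -> measurable_fun setT Y ->
  mu.-integrable setT (fun w => (X w ^+ 2)%:E) ->
  mu.-integrable setT (fun w => (Y w ^+ 2)%:E) ->
  mu.-integrable setT (fun w => (X w * Y w)%:E).
Proof.
move=> mX mY iX iY.
apply: (le_integrable _ _ _ (integrableD _ iX iY)) => //.
  by apply/measurable_EFinP/measurable_funM.
move=> w _ /=; rewrite lee_fin [leRHS]ger0_norm ?addr_ge0 ?sqr_ge0//.
rewrite ler_norml; apply/andP; split.
  by have := sqr_ge0 (X w + Y w); have := sqr_ge0 (X w); have := sqr_ge0 (Y w); nra.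
by have := sqr_ge0 (X w - Y w); have := sqr_ge0 (X w); have := sqr_ge0 (Y w); nra.
Qed.

Lemma L1_dist_triangle (f g h : T -> R) :
    measurable_fun setT f -> measurable_fun setT g -> measurable_fun setT h ->
  (\int[mu]_x `|f x - h x|%:E <=
   \int[mu]_x `|f x - g x|%:E + \int[mu]_x `|g x - h x|%:E)%E.
Proof.
move=> mf mg mh.
have mB (u v : T -> R) : measurable_fun setT u -> measurable_fun setT v ->
    measurable_fun setT (fun x => `|u x - v x|%:E).
  by move=> mu' mv; apply/measurable_EFinP/measurableT_comp => //; exact: measurable_funB.
rewrite -ge0_integralD//; [|exact: mB|exact: mB].
apply: ge0_le_integral => //; first exact: mB.
  by apply: emeasurable_funD; exact: mB.
by move=> x _; rewrite -EFinD lee_fin ler_distD.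
Qed.

(** An integrable function is finite almost everywhere, so [fine] alters it on a null set only. This
    links [Rintegral], which is a [fine], to the extended real inner integrals of Fubini's
    theorem. *)
Lemma integrable_fine (h : T -> \bar R) : mu.-integrable setT h ->
  mu.-integrable setT (EFin \o (fine \o h)) /\
  (\int[mu]_x (fine (h x))%:E = \int[mu]_x h x)%E.
Proof.
move=> ih; have mh := measurable_int _ ih.
have mfh : measurable_fun setT (EFin \o (fine \o h)).
  by apply/measurable_EFinP; exact: measurableT_comp.
split.
  apply: le_integrable ih => // x _ /=.
  by case: (h x) => [r| |] //=; rewrite normr0 leey.
apply: ae_eq_integral => //.
by apply: filterS (integrable_ae measurableT ih) => x /(_ Logic.I) hfin _; rewrite fineK.
Qed.

End integrable_fun.

(** * Fubini's theorem on products and on a triangle *)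

Lemma integrable_fubini_G d1 d2 (T1 : measurableType d1) (T2 : measurableType d2)
    (R : realType) (m1 : {sigma_finite_measure set T1 -> \bar R})
    (m2 : {sigma_finite_measure set T2 -> \bar R}) (f : T1 * T2 -> \bar R) :
  (m1 \x m2)%E.-integrable setT f -> m2.-integrable setT (fubini_G m1 f).
Proof.
move=> imf; have mf := measurable_int _ imf.
have mfabs : measurable_fun setT (abse \o f) by exact: measurableT_comp.
apply/integrableP; split; first exact: measurable_fubini_G imf.
apply: le_lt_trans ((integrable21ltyP _ _ mf).1 imf).
apply: ge0_le_integral => //.
- by apply: measurableT_comp => //; exact: measurable_fubini_G imf.
- by apply: (measurable_fun_fubini_tonelli_G (abse \o f)) => //= x.
- move=> y _; apply: le_abse_integral => //.
  exact: measurable_fun_pair1.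
Qed.

(** Both sides are iterated integrals, in the two orders, of [a s * b u] over the triangle [u <= s]
    of the unit square. *)
Lemma Rintegral_mul_Rintegral_itv (R : realType) (a b : R -> R) :
    (@lebesgue_measure R).-integrable `[0, 1] (EFin \o a) ->
    (@lebesgue_measure R).-integrable `[0, 1] (EFin \o b) ->
  \int[lebesgue_measure]_(s in `[0, 1]) (a s * \int[lebesgue_measure]_(u in `[0, s]) b u) =
  \int[lebesgue_measure]_(u in `[0, 1]) (\int[lebesgue_measure]_(s in `[u, 1]) a s * b u).
Proof.
move=> ia ib.
pose mes := @lebesgue_measure R.
pose I01 : set (measurableTypeR R) := [set` `[0, 1]].
have mI : measurable I01 by exact: measurable_itv.
have patchE (c : R -> R) : (EFin \o c) \_ I01 = EFin \o (c \_ I01).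
  by apply/funext => s; rewrite /= /patch; case: ifPn.
have ia' : mes.-integrable setT (EFin \o (a \_ I01)).
  by rewrite -patchE; apply/(integrable_mkcond _ mI).
have ib' : mes.-integrable setT (EFin \o (b \_ I01)).
  by rewrite -patchE; apply/(integrable_mkcond _ mI).
have ma : measurable_fun setT (a \_ I01) by apply/measurable_EFinP; exact: measurable_int ia'.
have mb : measurable_fun setT (b \_ I01) by apply/measurable_EFinP; exact: measurable_int ib'.
pose RR := (measurableTypeR R * measurableTypeR R)%type.
pose E : set RR := [set x | x.2 <= x.1].
have mE : measurable E.
  have := @measurable_fun_le _ RR R setT snd fst measurableT measurable_snd measurable_fst.
  by rewrite setTI.
pose k (x : RR) := (((a \_ I01) x.1 * (b \_ I01) x.2) * \1_E x)%:E.
have mk : measurable_fun setT k.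
  apply/measurable_EFinP; apply: measurable_funM; last exact: measurable_indic.
  apply: measurable_funM; first exact: measurableT_comp ma measurable_fst.
  exact: measurableT_comp mb measurable_snd.
(* The kernel is dominated by [|a s| * |b u|], whose double integral is the product of two finite
   integrals. *)
have ik : (mes \x mes)%E.-integrable setT k.
  apply/(integrable12ltyP _ _ mk).
  have fb := integrable_fin_num measurableT (integrable_abse ib').
  apply: (@le_lt_trans _ _ (\int[mes]_s (`|((a \_ I01) s)%:E| *
      \int[mes]_u `|((b \_ I01) u)%:E|))%E).
    apply: le_integral_nomeas => s; first exact: integral_ge0.
    rewrite -ge0_integralZl//; last first.
      by apply/measurable_EFinP; exact: measurableT_comp.
    apply: le_integral_nomeas => u //.
    rewrite /k /= -EFinM lee_fin !normrM ler_piMr ?mulr_ge0//.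
    by rewrite indicE; case: (_ \in _); rewrite ?normr1 ?normr0.
  rewrite -(fineK fb) ge0_integralZr//; last 2 first.
    by apply/measurable_EFinP; exact: measurableT_comp.
    by rewrite lee_fin; apply: fine_ge0; apply: integral_ge0 => u _; exact: abse_ge0.
  apply: lte_mul_pinfty; rewrite ?ltry//; first exact: integral_ge0.
  exact: integrable_fin_num (integrable_abse ia').
have sub (A : set (measurableTypeR R)) (c : R -> R) : measurable A -> A `<=` I01 ->
    mes.-integrable I01 (EFin \o c) -> mes.-integrable A (EFin \o c).
  by move=> mA AI; exact: integrableS.
have F1 s : I01 s -> (\int[mes]_u k (s, u) = (a s * \int[mes]_(u in `[0, s]) b u)%:E)%E.
  rewrite /I01 /= in_itv/= => s01; have [s0 s1] := andP s01.
  have is_ : mes.-integrable `[0, s] (EFin \o b).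
    apply: sub ib => //.
    by apply: subset_itvl; rewrite bnd_simp.
  rewrite EFinM /Rintegral fineK; last exact: integrable_fin_num is_.
  rewrite -integralZl//.
  rewrite [RHS]integral_mkcond; apply: eq_integral => u _.
  rewrite /k /= /patch indicE (mem_set (_ : I01 s)) /I01 ?/=; last by rewrite /= in_itv/=.
  case: ifPn => [/set_mem|/negP uN].
    rewrite /= in_itv/= => /andP[u0 u1].
    have -> : ((s, u) \in E) = (u \in `[0, s]%classic).
      apply/idP/idP => /set_mem.
        by move=> us; apply/mem_set; rewrite /= in_itv/= u0.
      by rewrite /= in_itv/= => /andP[_ us]; apply/mem_set.
    by case: ifPn; rewrite ?mulr1 ?mulr0.
  rewrite mulr0 mul0r memNset//= in_itv/= => /andP[u0 us].
  by apply: uN; apply/mem_set; rewrite /= in_itv/= u0 (le_trans us).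
have F2 u : I01 u -> (\int[mes]_s k (s, u) = (\int[mes]_(s in `[u, 1]) a s * b u)%:E)%E.
  rewrite /I01 /= in_itv/= => u01; have [u0 u1] := andP u01.
  have iu : mes.-integrable `[u, 1] (EFin \o a).
    apply: sub ia => //.
    by apply: subset_itvr; rewrite bnd_simp.
  rewrite EFinM /Rintegral fineK; last exact: integrable_fin_num iu.
  rewrite -integralZr//.
  rewrite [RHS]integral_mkcond; apply: eq_integral => s _.
  rewrite /k /= /patch indicE (mem_set (_ : I01 u)) /I01 ?/=; last by rewrite /= in_itv/=.
  case: ifPn => [/set_mem|/negP sN].
    rewrite /= in_itv/= => /andP[s0 s1].
    have -> : ((s, u) \in E) = (s \in `[u, 1]%classic).
      apply/idP/idP => /set_mem.
        by move=> us; apply/mem_set; rewrite /= in_itv/= us.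
      by rewrite /= in_itv/= => /andP[us _]; apply/mem_set.
    by case: ifPn; rewrite ?mulr1 ?mulr0.
  rewrite !mul0r memNset//= in_itv/= => /andP[us s1].
  by apply: sN; apply/mem_set; rewrite /= in_itv/= s1 (le_trans u0).
have N1 s : ~ I01 s -> (\int[mes]_u k (s, u) = 0)%E.
  by move=> sN; apply: integral0_eq => u _; rewrite /k /= /patch memNset// !mul0r.
have N2 u : ~ I01 u -> (\int[mes]_s k (s, u) = 0)%E.
  move=> uN; apply: integral0_eq => s _.
  by rewrite /k /= /patch (memNset (_ : ~ I01 u))// mulr0 mul0r.
rewrite /Rintegral; congr fine; rewrite integral_mkcond [RHS]integral_mkcond.
transitivity (\int[mes]_s \int[mes]_u k (s, u))%E.
  apply: eq_integral => s _; rewrite /patch; case: ifPn => [/set_mem sI|/negP sN].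
    by rewrite F1.
  by rewrite N1// => sI; apply: sN; exact: mem_set.
rewrite (Fubini ik); apply: eq_integral => u _; rewrite /patch.
case: ifPn => [/set_mem sI|/negP sN].
  by rewrite F2.
by rewrite N2// => sI; apply: sN; exact: mem_set.
Qed.

(** * Conditional expectations: existence, products, moments *)

Section cond_exp.
Context {d : measure_display} {Omega : measurableType d} {R : realType}.
Variables (P : probability Omega R) (G : set (set Omega)).
Hypotheses (sG : sigma_algebra setT G) (GM : G `<=` measurable).
Local Notation gT := (g_sigma_algebraType G).
Implicit Types X Y U D : Omega -> R.

Lemma measurable_gT (A : set gT) : measurable A = G A.
Proof. by rewrite /measurable/= sigma_algebra_id. Qed.

Lemma measurable_fun_gT Y :
  (forall B, measurable B -> G (Y @^-1` B)) <->
  measurable_fun (setT : set gT) (Y : gT -> R).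
Proof.
split=> [mY _ B mB|mY B mB].
  by rewrite setTI measurable_gT; exact: mY.
by rewrite -measurable_gT -[X in measurable X]setTI; exact: mY.
Qed.

Lemma measurable_id_gT : measurable_fun (setT : set Omega) (id : Omega -> gT).
Proof. by move=> _ B; rewrite setTI measurable_gT; exact: GM. Qed.

Lemma sub_measurable_fun Y : (forall B, measurable B -> G (Y @^-1` B)) ->
  measurable_fun setT Y.
Proof. by move=> mY _ B mB; rewrite setTI; apply: GM; exact: mY. Qed.

(** Radon-Nikodym on the sigma-field [G]: the charge with density [X] is dominated by [P] on [G],
    and its derivative [D] is [G]-measurable. The restriction of [P] to [G] is encoded as the
    distribution of the identity map from [Omega] to [gT]. *)
Lemma cond_exp_exists X : P.-integrable setT (EFin \o X) ->
  exists Y, is_cond_exp P G X Y.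
Proof.
move=> iX.
pose m0 := induced_charge iX.
have nu0 : m0 set0 = 0%E by exact: charge0.
have nufin (A : set gT) : measurable A -> m0 A \is a fin_num.
  by rewrite measurable_gT => /GM mA; exact: fin_num_measure.
have nuS : @measure_function.semi_sigma_additive _ R gT m0.
  move=> A mA tA mUA; apply: charge_semi_sigma_additive => //.
    by move=> n; apply: GM; rewrite -measurable_gT; exact: mA.
  by apply: GM; rewrite -measurable_gT.
pose nu : charge gT R := HB.pack_for (charge gT R) (m0 : set gT -> \bar R)
  (isCharge.Build _ gT R m0 nu0 nufin nuS).
pose j : {mfun Omega >-> gT} := HB.pack_for {mfun Omega >-> gT} (id : Omega -> gT)
  (isMeasurableFun.Build _ _ Omega gT id measurable_id_gT).
pose mu := distribution P j.
have numu : nu `<< mu.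
  apply/null_content_dominatesP => A; rewrite measurable_gT => /GM mA PA0.
  apply: null_set_integral => //.
  exact: measurable_int (integrableS measurableT mA _ iX).
pose D := Radon_Nikodym nu mu.
have Dfin x : D x \is a fin_num by exact: Radon_Nikodym_fin_num.
have iD : mu.-integrable setT D by exact: Radon_Nikodym_integrable.
have DE A : measurable A -> nu A = (\int[mu]_(x in A) D x)%E.
  exact: Radon_Nikodym_integral.
have mD : measurable_fun setT D by exact: measurable_int iD.
have mY : forall B : set R, measurable B -> G ((fun w => fine (D w)) @^-1` B).
  by apply/measurable_fun_gT; exact: measurableT_comp.
have DY : D = EFin \o (fun w => fine (D w)) by apply/funext => w /=; rewrite fineK.
have iY : P.-integrable setT (EFin \o (fun w => fine (D w))).
  apply/integrableP; split.
    apply/measurable_EFinP; exact: sub_measurable_fun.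
  rewrite -DY; case/integrableP: iD => _; rewrite ge0_integral_pushforward//.
  exact: measurableT_comp.
exists (fun w => fine (D w)); split => // A GA.
have mA : measurable (A : set gT) by rewrite measurable_gT.
rewrite /Rintegral; congr fine; have := DE A mA.
rewrite integral_pushforward//; last first.
  by rewrite DY; apply: integrableS iY => //; exact: GM.
by move=> nuA; rewrite -[RHS]/(nu A) nuA; apply: eq_integral => w _ /=; rewrite fineK.
Qed.

(* Layer cake: U w is the integral over t >= 0 of the indicator of t <= U w, so
   by Fubini only the integrals of D over the G-sets {U >= t} matter. *)
Lemma ge0_integral_mul_eq0 U D : (forall w, 0 <= U w) ->
    (forall B, measurable B -> G (U @^-1` B)) ->
    P.-integrable setT (EFin \o D) -> P.-integrable setT (EFin \o (U \* D)) ->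
    (forall A, G A -> (\int[P]_(w in A) (D w)%:E = 0)%E) ->
  (\int[P]_w (U w * D w)%:E = 0)%E.
Proof.
move=> U0 mU iD iUD D0.
have mU' : measurable_fun setT U by exact: sub_measurable_fun.
have mD : measurable_fun setT D by apply/measurable_EFinP; exact: measurable_int iD.
pose E : set (Omega * measurableTypeR R) :=
  [set x | 0 <= x.2] `&` [set x | x.2 <= U x.1].
have mE : measurable E.
  have := @measurable_fun_le _ (Omega * measurableTypeR R)%type R setT
    (cst 0) snd measurableT (@measurable_cst _ _ _ _ _ _) measurable_snd.
  have := @measurable_fun_le _ (Omega * measurableTypeR R)%type R setT
    snd (fun x => U x.1) measurableT measurable_snd (measurableT_comp mU' measurable_fst).
  by rewrite !setTI => mE2 mE1; exact: measurableI.
have EE w t : \1_E (w, t) = \1_`[0%R, U w] t :> R.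
  rewrite !indicE; congr (nat_of_bool _)%:R; apply/idP/idP => /set_mem.
    by move=> [/= t0 tU]; apply/mem_set; rewrite /= in_itv/= t0.
  by rewrite /= in_itv/= => /andP[t0 tU]; apply/mem_set; split.
pose f (x : Omega * measurableTypeR R) := (D x.1 * \1_E x)%:E.
have mf : measurable_fun setT f.
  apply/measurable_EFinP; apply: measurable_funM; last exact: measurable_indic.
  exact: measurableT_comp mD measurable_fst.
(* Integrating [|f|] over [t] gives [|U * D|], integrable by hypothesis. *)
have iF : (P \x (@lebesgue_measure R))%E.-integrable setT f.
  apply/(integrable12ltyP _ _ mf).
  case/integrableP: iUD => _; apply: le_lt_trans.
  rewrite le_eqVlt; apply/orP; left; apply/eqP; apply: eq_integral => w _.
  rewrite /= normrM (ger0_norm (U0 w)) mulrC -integral_mul_itv_indic//.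
  by apply: eq_integral => t _; rewrite /f /= normrM EE [X in _ * X]ger0_norm.
transitivity (\int[P]_w \int[lebesgue_measure]_t f (w, t))%E.
  apply: eq_integral => w _; rewrite mulrC -integral_mul_itv_indic//.
  by apply: eq_integral => t _; rewrite /f EE.
rewrite (Fubini iF); apply: integral0_eq => t _.
have [t0|t0] := leP 0 t.
  rewrite -(D0 (U @^-1` `[t, +oo[)); last by apply: mU; exact: measurable_itv.
  rewrite [RHS]integral_mkcond; apply: eq_integral => w _.
  rewrite /f EE /= patchE indicE.
  have -> : (w \in U @^-1` `[t, +oo[) = (t \in `[0%R, U w]%classic).
    apply/idP/idP => /set_mem; rewrite /= in_itv/=.
      by rewrite andbT => tU; apply/mem_set; rewrite /= in_itv/= t0.
    by move=> /andP[_ tU]; apply/mem_set; rewrite /= in_itv/= tU.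
  by case: ifPn; rewrite ?mulr1 ?mulr0.
apply: integral0_eq => w _; rewrite /f EE /= indicE memNset ?mulr0//=.
by rewrite in_itv/= leNgt t0.
Qed.

(** The difference [D = Y - X] has integral 0 over every set of [G], so [ge0_integral_mul_eq0]
    applies to the positive and the negative part of [U] separately. Integrability is asked of the
    products only, which admits unbounded [U] such as a section of an element of [L_p]. *)
Lemma cond_exp_mul X Y U : is_cond_exp P G X Y ->
    (forall B, measurable B -> G (U @^-1` B)) ->
    P.-integrable setT (EFin \o (U \* X)) ->
    P.-integrable setT (EFin \o (U \* Y)) ->
  (\int[P]_w (U w * Y w)%:E = \int[P]_w (U w * X w)%:E)%E.
Proof.
move=> [iX iY mY XY] mU iUX iUY.
pose D := Y \- X.
have iD : P.-integrable setT (EFin \o D).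
  exact: integrable_EFinB.
have D0 A : G A -> (\int[P]_(w in A) (D w)%:E = 0)%E.
  move=> GA; have mA := GM GA.
  have iXA := integrableS measurableT mA (@subsetT _ _) iX.
  have iYA := integrableS measurableT mA (@subsetT _ _) iY.
  under eq_integral do rewrite EFinB.
  have := congr1 EFin (XY A GA).
  rewrite /Rintegral !fineK ?integrable_fin_num// integralB// => ->.
  by rewrite subee// integrable_fin_num.
have mD : measurable_fun setT D by apply/measurable_EFinP; exact: measurable_int iD.
have iUD : P.-integrable setT (EFin \o (U \* D)).
  rewrite (_ : U \* D = (U \* Y) \- (U \* X)); first exact: integrable_EFinB.
  by apply/funext => w /=; rewrite -mulrBr.
have part V : (forall w, 0 <= V w) -> (forall w, V w <= `|U w|) ->
    (forall B, measurable B -> G (V @^-1` B)) ->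
    P.-integrable setT (EFin \o (V \* D)) /\ (\int[P]_w (V w * D w)%:E = 0)%E.
  move=> V0 VU mV.
  have iVD : P.-integrable setT (EFin \o (V \* D)).
    apply: le_integrable iUD => //.
      by apply/measurable_EFinP; apply: measurable_funM => //; exact: sub_measurable_fun.
    by move=> w _; rewrite /= lee_fin !normrM ler_wpM2r// ger0_norm.
  by split => //; exact: ge0_integral_mul_eq0.
have [iVp Vp0] : P.-integrable setT (EFin \o (U^\+ \* D)) /\
    (\int[P]_w (U^\+ w * D w)%:E = 0)%E.
  apply: part; first exact: funrpos_ge0.
    by move=> w; rewrite /funrpos ge_max normr_ge0 ler_norm.
  by apply/measurable_fun_gT/measurable_funrpos/measurable_fun_gT.
have [iVn Vn0] : P.-integrable setT (EFin \o (U^\- \* D)) /\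
    (\int[P]_w (U^\- w * D w)%:E = 0)%E.
  apply: part; first exact: funrneg_ge0.
    by move=> w; rewrite /funrneg ge_max normr_ge0 -normrN ler_norm.
  by apply/measurable_fun_gT/measurable_funrneg/measurable_fun_gT.
have : (\int[P]_w ((U w * Y w)%:E - (U w * X w)%:E) = 0)%E.
  transitivity (\int[P]_w ((U^\+ w * D w)%:E - (U^\- w * D w)%:E))%E.
    apply: eq_integral => w _; rewrite -!EFinB -mulrBr -mulrBl.
    by congr (_ * _)%:E; rewrite -{1}[U]funrposBneg.
  by rewrite integralB// Vp0 Vn0 sube0.
rewrite integralB// => /eqP; rewrite sube_eq ?add0e; first by move/eqP.
  exact: integrable_fin_num.
by rewrite fin_num_adde_defl// integrable_fin_num.
Qed.

Lemma cond_expB X Y X' Y' : is_cond_exp P G X Y -> is_cond_exp P G X' Y' ->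
  is_cond_exp P G (X \- X') (Y \- Y').
Proof.
move=> [iX iY mY XY] [iX' iY' mY' XY'].
split; [exact: integrable_EFinB|exact: integrable_EFinB| |].
  by apply/measurable_fun_gT/measurable_funB; apply/measurable_fun_gT.
move=> A GA; have mA := GM GA.
have S (U : Omega -> R) : P.-integrable setT (EFin \o U) -> P.-integrable A (EFin \o U).
  exact: integrableS.
by rewrite !RintegralB ?S// XY// XY'.
Qed.

(** Testing against the sign of [Y], a bounded [G]-measurable function, turns [|Y|] into [U * Y].
    This is the exponent 1, whereas [cond_exp_powR_le] treats exponents above 1. *)
Lemma cond_exp_abs_le X Y : is_cond_exp P G X Y ->
  (\int[P]_w `|Y w|%:E <= \int[P]_w `|X w|%:E)%E.
Proof.
move=> XY; have [iX iY mY _] := XY.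
pose U w : R := if Y w < 0 then -1 else 1.
have mU : forall B, measurable B -> G (U @^-1` B).
  apply/measurable_fun_gT.
  apply: measurable_fun_ifT => //.
  by apply: measurable_fun_ltr => //; exact/measurable_fun_gT.
have U1 w : `|U w| <= 1 by rewrite /U; case: ifPn => _; rewrite ?normrN normr1.
have mU' := sub_measurable_fun mU.
have iUX := integrable_bounded_mul mU' U1 iX.
have iUY := integrable_bounded_mul mU' U1 iY.
rewrite [leLHS](_ : _ = \int[P]_w (U w * Y w)%:E)%E; last first.
  apply: eq_integral => w _; rewrite /U; case: ltP => Y0.
    by rewrite ltr0_norm// mulN1r.
  by rewrite mul1r ger0_norm.
rewrite (cond_exp_mul XY mU iUX iUY).
apply: le_integral => //.
  by case/integrableP: (integrable_abse iX) => mX iX'; apply/integrableP.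
move=> w _; rewrite lee_fin (le_trans (ler_norm _))// normrM.
by rewrite -[leRHS]mul1r ler_wpM2r.
Qed.

(* Young's inequality applied to E[U Y] = E[U X] with U = sgn(Y) |Y|^(q-1),
   truncated at n, replaces Jensen's inequality. *)
Lemma cond_exp_powR_le (q : R) X Y : 1 < q -> is_cond_exp P G X Y ->
  (\int[P]_w (`|Y w| `^ q)%:E <= \int[P]_w (`|X w| `^ q)%:E)%E.
Proof.
move=> q1 XY; have [iX iY mY _] := XY.
have q0 : 0 < q by exact: lt_trans q1.
have q10 : 0 < q - 1 by rewrite subr_gt0.
set B := (leRHS).
have [Boo|] := ltP B +oo%E; last by rewrite leye_eq => /eqP ->; rewrite leey.
have B0 : (0 <= B)%E by apply: integral_ge0 => w _; rewrite lee_fin powR_ge0.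
have Bfin : B \is a fin_num by rewrite ge0_fin_numE.
have mYg : measurable_fun (setT : set gT) Y by exact/measurable_fun_gT.
have mYO : measurable_fun setT Y by exact: (sub_measurable_fun).
have mXO : measurable_fun setT X by apply/measurable_EFinP; exact: measurable_int iX.
(* The truncation makes the integral of [m n ^ q] finite, so that a multiple of it can be subtracted
   from both sides of [a_le]. *)
pose m n w : R := Num.min `|Y w| n%:R.
have m0 n w : 0 <= m n w by rewrite le_min normr_ge0/=.
have mm n : measurable_fun (setT : set gT) (m n).
  by apply: measurable_minr => //; exact: measurableT_comp.
pose U n w : R := if Y w < 0 then - (m n w `^ (q - 1)) else m n w `^ (q - 1).
have mUg n : measurable_fun (setT : set gT) (U n).
  have mp : measurable_fun (setT : set gT) (fun w => m n w `^ (q - 1)).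
    by apply: (@measurableT_comp _ _ _ _ _ _ (@powR R ^~ (q - 1))).
  apply: measurable_fun_ifT => //; last exact: measurableT_comp.
  exact: measurable_fun_ltr.
have mU n : forall B, measurable B -> G (U n @^-1` B).
  exact/measurable_fun_gT.
have mU' n := sub_measurable_fun (mU n).
have absU n w : `|U n w| = m n w `^ (q - 1).
  by rewrite /U; case: ifPn => _; rewrite ?normrN ger0_norm// powR_ge0.
have Un n w : `|U n w| <= n%:R `^ (q - 1).
  rewrite absU ge0_ler_powR ?nnegrE // ?(ltW q10)//.
  by rewrite ge_min lexx orbT.
have iUX n := integrable_bounded_mul (mU' n) (Un n) iX.
have iUY n := integrable_bounded_mul (mU' n) (Un n) iY.
have UYm n w : m n w `^ q <= U n w * Y w.
  have -> : U n w * Y w = m n w `^ (q - 1) * `|Y w|.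
    by rewrite /U; case: ltP => Y0; [rewrite ltr0_norm// mulNr mulrN|rewrite ger0_norm].
  rewrite -{1}(subrK 1 q) [leLHS]powRD; last by rewrite subrK (gt_eqF q0).
  by rewrite powRr1// ler_wpM2l ?powR_ge0// ge_min lexx.
pose p := q / (q - 1).
have p0 : 0 < p by rewrite divr_gt0.
have qp : q^-1 + p^-1 = 1.
  by rewrite /p invf_div mulrBl divff ?gt_eqF// mul1r addrC subrK.
(* The conjugate exponent satisfies [(q - 1) * p = q]. *)
have Up n w : `|U n w| `^ p = m n w `^ q.
  by rewrite absU -powRrM /p mulrCA divff ?mulr1// gt_eqF.
have mXq : measurable_fun setT (fun w => `|X w| `^ q).
  by apply: (@measurableT_comp _ _ _ _ _ _ (@powR R ^~ q)) => //; exact: measurableT_comp.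
have iXq : P.-integrable setT (fun w => (`|X w| `^ q)%:E).
  apply/integrableP; split; first exact/measurable_EFinP.
  by under eq_integral do rewrite gee0_abs ?lee_fin ?powR_ge0//.
have mmq n : measurable_fun setT (fun w => (m n w `^ q)%:E).
  apply/measurable_EFinP; apply: (@measurableT_comp _ _ _ _ _ _ (@powR R ^~ q)) => //.
  by apply: measurable_minr => //; exact: measurableT_comp.
have imq n : P.-integrable setT (fun w => (m n w `^ q)%:E).
  apply: (le_integrable _ _ _ (finite_measure_integrable_cst P (n%:R `^ q) measurableT)) => //.
  move=> w _; rewrite /= lee_fin ger0_norm ?powR_ge0// ger0_norm ?powR_ge0//.
  by rewrite ge0_ler_powR ?nnegrE ?(ltW q0)// ge_min lexx orbT.
have aB n : (\int[P]_w (m n w `^ q)%:E <= B)%E.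
  set a := (leLHS).
  have afin : a \is a fin_num by exact: integrable_fin_num.
  have a_le : (a <= q^-1%:E * B + p^-1%:E * a)%E.
    rewrite -!integralZl// -integralD//; [|exact: integrableZl..].
    apply: (@le_trans _ _ (\int[P]_w (U n w * X w)%:E)%E).
      rewrite -(cond_exp_mul XY (mU n) (iUX n) (iUY n)).
      by apply: le_integral => //; [exact: iUY|move=> w _; rewrite lee_fin].
    apply: le_integral => //; first exact: iUX.
      by apply: integrableD => //; exact: integrableZl.
    move=> w _; rewrite -!EFinM -EFinD lee_fin (le_trans (ler_norm _))// normrM.
    rewrite [_^-1 * _]mulrC [p^-1 * _]mulrC -Up addrC [_ * `|X w|]mulrC addrC.
    exact: conjugate_powR.
  move: a_le; rewrite -(fineK afin) -(fineK Bfin) -!EFinM -EFinD !lee_fin.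
  (* The finite term [p^-1 * a] is absorbed on the left, leaving [q^-1 * a <= q^-1 * B]. *)
  have -> : p^-1 = 1 - q^-1 by rewrite -qp addrC addKr.
  rewrite mulrBl mul1r addrCA lerDl subr_ge0 ler_pM2l// invr_gt0//.
have mq_nd k l w : (k <= l)%N -> m k w `^ q <= m l w `^ q.
  move=> kl; apply: ge0_ler_powR; rewrite ?nnegrE//; first exact: ltW.
  by rewrite le_min !ge_min lexx ler_nat kl orbT.
(* The bound by [B] is uniform in [n], so monotone convergence removes the truncation. *)
have -> : (\int[P]_w (`|Y w| `^ q)%:E = \int[P]_w limn (fun n => (m n w `^ q)%:E))%E.
  apply: eq_integral => w _; apply/esym/cvg_lim => //.
  apply: cvg_near_cst; near=> n; congr (_ `^ _)%:E; apply/min_idPl.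
  near: n; exact: nbhs_infty_ger.
rewrite monotone_convergence//.
- apply: lime_le; last exact: nearW.
  apply: ereal_nondecreasing_is_cvgn => k l kl; apply: le_integral => // w _.
  by rewrite lee_fin mq_nd.
- by move=> n w _; rewrite lee_fin powR_ge0.
- by move=> w _ k l kl; rewrite lee_fin mq_nd.
Unshelve. all: by end_near.
Qed.

Lemma cond_exp_sqr_integrable X Y : is_cond_exp P G X Y ->
  P.-integrable setT (fun w => (X w ^+ 2)%:E) ->
  P.-integrable setT (fun w => (Y w ^+ 2)%:E).
Proof.
move=> XY iX2; have [iX iY mY _] := XY.
have mY' := sub_measurable_fun mY.
apply/integrableP; split.
  by apply/measurable_EFinP; exact: measurable_funX.
case/integrableP: iX2 => _; apply: le_lt_trans.
have E (Z : Omega -> R) : (\int[P]_w `|(Z w ^+ 2)%:E| = \int[P]_w (`|Z w| `^ 2)%:E)%E.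
  apply: eq_integral => w _; rewrite gee0_abs ?lee_fin ?sqr_ge0//.
  by rewrite powR_mulrn// real_normK ?num_real.
by rewrite !E; apply: cond_exp_powR_le XY; rewrite ltr1n.
Qed.

(** Pythagoras: [X - Y] is orthogonal to the [G]-measurable [Y], so the integrals of [Y * X] and
    [Y * Y] agree. *)
Lemma cond_exp_sqr_dist X Y : is_cond_exp P G X Y ->
  P.-integrable setT (fun w => (X w ^+ 2)%:E) ->
  \int[P]_w (X w - Y w) ^+ 2 = \int[P]_w X w ^+ 2 - \int[P]_w Y w ^+ 2.
Proof.
move=> XY iX2; have [iX iY mY _] := XY.
have iY2 := cond_exp_sqr_integrable XY iX2.
have mY' := sub_measurable_fun mY.
have mX' : measurable_fun setT X by apply/measurable_EFinP; exact: measurable_int iX.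
have iYX := integrable_mul_sqr mY' mX' iY2 iX2.
have iYY := integrable_mul_sqr mY' mY' iY2 iY2.
have YYX : \int[P]_w (Y w * Y w) = \int[P]_w (Y w * X w).
  by congr fine; exact: (cond_exp_mul XY mY iYX iYY).
have iD : P.-integrable setT (EFin \o (fun w => Y w * Y w - Y w * X w)).
  exact: (integrable_EFinB iYY iYX).
have iXmY : P.-integrable setT (EFin \o (fun w => X w ^+ 2 - Y w ^+ 2)).
  exact: (integrable_EFinB iX2 iY2).
transitivity (\int[P]_w ((X w ^+ 2 - Y w ^+ 2) + 2 * (Y w * Y w - Y w * X w))).
  by apply: eq_Rintegral => w _; ring.
rewrite RintegralD//; last by apply/(integrableZl measurableT 2) : iD.
rewrite RintegralZl// !RintegralB//.
by rewrite YYX subrr mulr0 addr0.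
Qed.

End cond_exp.

(** * Square integrable approximation and the tower property *)

Section martingale.
Context {d : measure_display} {Omega : measurableType d} {R : realType}.
Variables (P : probability Omega R).

(** Replacing [X] by 0 where [|X| > n] gives bounded functions, dominated by [|X|] and eventually
    equal to [X] at each point; dominated convergence applies. *)
Lemma integrable_sqr_approx (X : Omega -> R) (e : R) : 0 < e ->
    P.-integrable setT (EFin \o X) -> exists Y : Omega -> R,
  [/\ P.-integrable setT (EFin \o Y), P.-integrable setT (fun w => (Y w ^+ 2)%:E) &
      (\int[P]_w `|X w - Y w|%:E <= e%:E)%E].
Proof.
move=> e0 iX.
have mX : measurable_fun setT X by apply/measurable_EFinP; exact: measurable_int iX.
pose Y n w := if `|X w| <= n%:R then X w else 0.
have mY n : measurable_fun setT (Y n).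
  apply: measurable_fun_ifT => //; apply: measurable_fun_ler => //.
  exact: measurableT_comp.
have YX n w : `|Y n w| <= `|X w| by rewrite /Y; case: ifPn; rewrite ?normr0.
have Yn n w : `|Y n w| <= n%:R by rewrite /Y; case: ifPn; rewrite ?normr0.
have iY n : P.-integrable setT (EFin \o Y n).
  apply: le_integrable iX => //; first exact/measurable_EFinP.
  by move=> w _; rewrite lee_fin.
have iY2 n : P.-integrable setT (fun w => (Y n w ^+ 2)%:E).
  apply: (le_integrable _ _ _ (finite_measure_integrable_cst P (n%:R ^+ 2) measurableT)) => //.
    by apply/measurable_EFinP; exact: measurable_funX.
  move=> w _; rewrite lee_fin /= !normrX lerXn2r ?nnegrE//.
  by rewrite [leRHS]ger0_norm.
have YcvgX : {ae P, forall w, setT w -> (EFin \o Y n) w @[n --> \oo] --> (EFin \o X) w}.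
  apply: aeW => w _; apply/cvg_EFin; first exact: nearW.
  apply: cvg_near_cst; near=> n; rewrite /= /Y ifT//.
  near: n; exact: nbhs_infty_ger.
have YleX : {ae P, forall w n, setT w ->
    (`|(EFin \o Y n) w| <= (abse \o (EFin \o X)) w)%E}.
  by apply: aeW => w n _ /=; rewrite lee_fin.
have [_ + _] := dominated_convergence measurableT (fun n => measurable_int _ (iY n))
  (measurable_int _ iX) YcvgX (integrable_abse iX) YleX.
move=> /fine_cvgP[[k _ kfin]] /cvgrPdist_le /(_ e e0)[n _ ne].
(* An index at least [k] makes the integral finite, so that [fine] loses nothing; at least [n] makes
   it at most [e]. *)
exists (Y (maxn n k)); split => //.
rewrite [leLHS](_ : _ = (\int[P]_w `|(EFin \o Y (maxn n k)) w - (EFin \o X) w|)%E); last first.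
  by apply: eq_integral => w _; rewrite /= distrC.
rewrite -[leLHS](fineK (kfin _ (leq_maxr n k))) lee_fin.
by apply: le_trans (ne _ (leq_maxl n k)); rewrite sub0r normrN ler_norm.
Unshelve. all: by end_near.
Qed.

Variables (F : filtration Omega R) (X : Omega -> R) (M : R -> Omega -> R).
Hypothesis MX : forall t, 0 <= t <= 1 -> is_cond_exp P (F t) X (M t).

Lemma cond_exp_tower s t : 0 <= s -> s <= t -> t <= 1 ->
  is_cond_exp P (F s) (M t) (M s).
Proof.
move=> s0 st t1.
have [iX iMt _ XMt] := MX (introT andP (conj (le_trans s0 st) t1)).
have [_ iMs mMs XMs] := MX (introT andP (conj s0 (le_trans st t1))).
split => // A FA; rewrite XMs// XMt//.
exact: (@Ft_nondecreasing _ _ _ F s t).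
Qed.
End martingale.

(** * The Cauchy property in L^1 as time decreases to [t] *)

Section right_cauchy.
Context {d : measure_display} {Omega : measurableType d} {R : realType}.
Variables (P : probability Omega R) (F : filtration Omega R).

(* For s <= r, E[(M_r - M_s)^2] = phi r - phi s with phi u = E[M_u^2]
   nondecreasing, and phi has a right limit at t. *)
Lemma sqr_martingale_right_cauchy (X : Omega -> R) (M : R -> Omega -> R) (t e : R) :
    (forall t, 0 <= t <= 1 -> is_cond_exp P (F t) X (M t)) ->
    P.-integrable setT (fun w => (X w ^+ 2)%:E) -> 0 <= t < 1 -> 0 < e ->
  exists2 r, t < r <= 1 & forall s, t < s <= r ->
    (\int[P]_w `|M r w - M s w|%:E <= e%:E)%E.
Proof.
move=> MX iX2 /andP[t0 t1] e0.
have sF u : 0 <= u <= 1 -> sigma_algebra setT (F u) by exact: Ft_sigma_algebra.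
have FM u : 0 <= u <= 1 -> F u `<=` measurable by exact: Ft_measurable.
pose phi u := \int[P]_w M u w ^+ 2.
pose S := [set phi u | u in `]t, 1]].
have hS : has_inf S.
  split; first by exists (phi 1), 1; rewrite //= in_itv/= t1 lexx.
  by exists 0 => _ [u _ <-]; apply: Rintegral_ge0 => w _; exact: sqr_ge0.
pose h := e / 2.
have h0 : 0 < h by rewrite divr_gt0.
(* The infimum bounds every [phi s] from below, so a single [r] with [phi r] within [h ^ 2] of it
   serves all [s] in []t, r]]. *)
have [_ [r + <-]] := inf_adherent (exprn_gt0 2 h0) hS.
rewrite /= in_itv/= => /andP[tr r1] phir.
exists r; rewrite ?tr// => s /andP[ts sr].
have s01 : 0 <= s <= 1 by rewrite (le_trans t0 (ltW ts)) (le_trans sr).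
have r01 : 0 <= r <= 1 by rewrite (le_trans t0 (ltW tr)).
have MM := cond_exp_tower MX (le_trans t0 (ltW ts)) sr r1.
have iM2 := cond_exp_sqr_integrable (sF r r01) (FM r r01) (MX r r01) iX2.
have d2 : \int[P]_w (M r w - M s w) ^+ 2 <= h ^+ 2.
  rewrite (cond_exp_sqr_dist (sF s s01) (FM s s01) MM iM2).
  have : inf S <= phi s.
    apply: ge_inf; first by case: hS.
    by exists s => //=; rewrite in_itv/= ts (le_trans sr).
  by move: phir; rewrite -/(phi r) -/(phi s); lra.
have [_ iMr mMr _] := MX r r01; have [_ iMs mMs _] := MX s s01.
have mMr' := sub_measurable_fun (FM r r01) mMr.
have mMs' := sub_measurable_fun (FM s s01) mMs.
have iMs2 := cond_exp_sqr_integrable (sF s s01) (FM s s01) (MX s s01) iX2.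
have iD2 : P.-integrable setT (fun w => ((M r w - M s w) ^+ 2)%:E).
  have iMM := integrable_mul_sqr mMr' mMs' iM2 iMs2.
  rewrite (_ : (fun _ => _) = ((fun w => (M r w ^+ 2)%:E) \+ (fun w => (M s w ^+ 2)%:E)
    \- (fun w => 2%:E * (M r w * M s w)%:E))%E).
    by apply: integrableB => //; [exact: integrableD|exact: integrableZl].
  by apply/funext => w /=; rewrite -[RHS]/(_%:E)%E; congr EFin; ring.
have iB := integrableZl measurableT h^-1 iD2.
have ih := finite_measure_integrable_cst P h measurableT.
have ie := integrableD measurableT iB ih.
(* From L^2 to L^1 by [|x| <= x ^ 2 / h + h]: each term integrates to at most [h], half of [e]. *)
apply: (@le_trans _ _ (\int[P]_w ((h^-1)%:E * ((M r w - M s w) ^+ 2)%:E + h%:E))%E).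
  apply: ge0_le_integral => //.
  - by apply/measurable_EFinP; apply: measurableT_comp => //; exact: measurable_funB.
  - exact: measurable_int ie.
  - move=> w _; rewrite -EFinM -EFinD lee_fin; set x := M r w - M s w.
    rewrite -(ler_pM2l h0) mulrDr mulrA divff ?gt_eqF// mul1r -real_normK ?num_real//.
    by have := sqr_ge0 (`|x| - h); have := normr_ge0 x; nra.
rewrite integralD// integralZl// integral_cst//. 
rewrite [X in (_ + _ * X)%E](_ : _ = 1%E) ?mule1; last exact: probability_setT.
have d2e : (\int[P]_w ((M r w - M s w) ^+ 2)%:E <= (h ^+ 2)%:E)%E.
  by rewrite -[leLHS]fineK ?lee_fin// integrable_fin_num.
apply: (@le_trans _ _ ((h^-1)%:E * (h ^+ 2)%:E + h%:E)%E).
  by rewrite leeD2r// lee_wpmul2l// lee_fin invr_ge0 ltW.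
by rewrite -EFinM -EFinD lee_fin expr2 mulKf ?gt_eqF// /h; lra.
Qed.

(** Conditional expectation contracts L^1-distances, so a square integrable [Y] close to [X] has a
    martingale [N] close to [M] uniformly in time. The three thirds of [e] are [M r] to [N r], [N r]
    to [N s], and [N s] to [M s]. *)
Lemma martingale_right_cauchy (X : Omega -> R) (M : R -> Omega -> R) (t e : R) :
    (forall t, 0 <= t <= 1 -> is_cond_exp P (F t) X (M t)) ->
    0 <= t < 1 -> 0 < e ->
  exists2 r, t < r <= 1 & forall s, t < s <= r ->
    (\int[P]_w `|M r w - M s w|%:E <= e%:E)%E.
Proof.
move=> MX t01 e0; have [/andP[t0 t1]] := t01.
have sF u : 0 <= u <= 1 -> sigma_algebra setT (F u) by exact: Ft_sigma_algebra.
have FM u : 0 <= u <= 1 -> F u `<=` measurable by exact: Ft_measurable.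
have [iX _ _ _] := MX 0 (introT andP (conj (lexx _) ler01)).
have e3 : 0 < e / 3 by rewrite divr_gt0.
have [Y [iY iY2 XY]] := integrable_sqr_approx e3 iX.
have /choice [N NY] : forall t, exists N, 0 <= t <= 1 -> is_cond_exp P (F t) Y N.
  move=> u; have [u01|] := boolP (0 <= u <= 1); last by exists (cst 0).
  by have [N ?] := cond_exp_exists (sF u u01) (FM u u01) iY; exists N.
have [r r01 hr] := sqr_martingale_right_cauchy NY iY2 t01 e3.
exists r => // s /andP[ts sr]; have /andP[tr r1] := r01.
have MN u : 0 <= u <= 1 -> (\int[P]_w `|M u w - N u w|%:E <= (e / 3)%:E)%E.
  move=> u01; apply: le_trans XY.
  have XYMN := cond_expB (sF u u01) (FM u u01) (MX u u01) (NY u u01).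
  exact: (cond_exp_abs_le (sF u u01) (FM u u01) XYMN).
have s01 : 0 <= s <= 1 by rewrite (le_trans t0 (ltW ts)) (le_trans sr).
have r01' : 0 <= r <= 1 by rewrite (le_trans t0 (ltW tr)).
have mM u : 0 <= u <= 1 -> measurable_fun setT (M u).
  by move=> u01; have [_ iM _ _] := MX u u01; apply/measurable_EFinP; exact: measurable_int iM.
have mN u : 0 <= u <= 1 -> measurable_fun setT (N u).
  by move=> u01; have [_ iN _ _] := NY u u01; apply/measurable_EFinP; exact: measurable_int iN.
apply: le_trans (L1_dist_triangle P (mM _ r01') (mN _ r01') (mM _ s01)) _.
rewrite (_ : e = e / 3 + (e / 3 + e / 3)); last by lra.
rewrite !EFinD; apply: leeD; first exact: MN.
apply: le_trans (L1_dist_triangle P (mN _ r01') (mN _ s01) (mM _ s01)) _.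
apply: leeD; first by apply: hr; rewrite ts.
by under eq_integral do rewrite distrC; exact: MN.
Qed.

End right_cauchy.

(** * Limits of fast L^1-Cauchy sequences *)

Section fast_limit.
Context {d : measure_display} {Omega : measurableType d} {R : realType}.
Variables (P : probability Omega R) (z : nat -> Omega -> R).
Hypotheses (iz : forall k, P.-integrable setT (EFin \o z k))
  (z_fast : forall k, (\int[P]_w `|z k.+1 w - z k w|%:E <= (1 / (2 ^ k.+1)%:R)%:E)%E).

Let Z w := fine (limn_esup (fun k => (z k w)%:E)).

(** The absolute increments have a sum [s] of expectation at most 1, so the telescoping series
    converges absolutely almost surely. All [z k] are dominated by [|z 0| + s], and dominated
    convergence passes to the limit over [A]. *)
Lemma L1_fast_limit : P.-integrable setT (EFin \o Z) /\
  forall A, measurable A -> (\int[P]_(w in A) z k w) @[k --> \oo] --> \int[P]_(w in A) Z w.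
Proof.
have mz k : measurable_fun setT (z k) by apply/measurable_EFinP; exact: measurable_int (iz k).
have mdz k : measurable_fun setT (fun w => `|z k.+1 w - z k w|%:E).
  by apply/measurable_EFinP; apply: measurableT_comp => //; exact: measurable_funB.
pose s w := (\sum_(k <oo) `|z k.+1 w - z k w|%:E)%E.
have s0 w : (0 <= s w)%E by exact: nneseries_ge0.
have ms : measurable_fun setT s by exact: ge0_emeasurable_sum.
have is_ : P.-integrable setT s.
  apply/integrableP; split => //.
  under eq_integral do rewrite gee0_abs//.
  rewrite integral_nneseries//.
  apply: (@le_lt_trans _ _ (\sum_(k <oo) (1 / (2 ^ k.+1)%:R)%:E)%E).
    by apply: lee_nneseries => // k _ _; exact: integral_ge0.
  by apply: (le_lt_trans (epsilon_trick0 xpredT ler01)); rewrite ltry.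
have iz0 := integrable_abse (iz 0).
pose g := ((abse \o (EFin \o z 0%N)) \+ s)%E.
have ig : P.-integrable setT g by exact: integrableD.
have zE w n : z n w = z 0%N w + series (telescope (z ^~ w)) n by exact: eq_sum_telescope.
have zg w n : (`|(z n w)%:E| <= g w)%E.
  rewrite zE /g /= (@le_trans _ _ (`|z 0%N w|%:E + `|series (telescope (z ^~ w)) n|%:E)%E)//.
    by rewrite -EFinD lee_fin ler_normD.
  rewrite leeD2l//.
  apply: le_trans (nneseries_lim_ge n _); last by [].
  by rewrite /= sumEFin lee_fin /series/= ler_norm_sum.
have zcvg : {ae P, forall w, setT w -> (EFin \o z n) w @[n --> \oo] --> (EFin \o Z) w}.
  apply: filterS (integrable_ae measurableT is_) => w /(_ Logic.I) sfin _.
  have cz : cvgn (z ^~ w).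
    have : cvgn (series (telescope (z ^~ w))).
      apply: normed_cvg; apply: nnseries_is_cvg => [k|]; first exact: normr_ge0.
      by move: sfin; rewrite ge0_fin_numE ?s0.
    rewrite telescopeK => cz.
    rewrite (_ : z ^~ w = (fun n => z 0%N w + (z n w - z 0%N w))).
      by apply: is_cvgD => //; exact: is_cvg_cst.
    by apply/funext => n; rewrite addrC subrK.
  have cE : (z n w)%:E @[n --> \oo] --> (limn (z ^~ w))%:E.
    by apply: cvg_EFin; [exact: nearW|exact: cz].
  by rewrite /Z /= (cvg_limn_einf_sup cE).2.
have gz : {ae P, forall w n, setT w -> (`|(EFin \o z n) w| <= g w)%E}.
  by apply: aeW => w n _ /=; exact: zg.
have mZ : measurable_fun setT (EFin \o Z).
  apply/measurable_EFinP; apply: measurableT_comp => //.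
  by apply: measurable_fun_limn_esup => n; exact/measurable_EFinP.
have [iZ _ _] := dominated_convergence measurableT (fun n => measurable_int _ (iz n))
  mZ zcvg ig gz.
split => // A mA.
have sub (h : Omega -> \bar R) : P.-integrable setT h -> P.-integrable A h.
  exact: integrableS.
have [_ _] := dominated_convergence mA
  (fun n => measurable_int _ (sub _ (iz n))) (measurable_funTS mZ)
  (filterS (fun w h _ => h Logic.I) zcvg) (sub _ ig)
  (filterS (fun w h n _ => h n Logic.I) gz).
rewrite -(fineK (integrable_fin_num mA (sub _ iZ))).
by move/fine_cvg.
Qed.
End fast_limit.

(** * A progressively measurable version of the martingale *)

Section progressive_version.
Context {d : measure_display} {Omega : measurableType d} {R : realType}.
Variables (P : probability Omega R) (F : filtration Omega R).
Variables (X : Omega -> R) (M : R -> Omega -> R).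
Hypothesis MX : forall t, 0 <= t <= 1 -> is_cond_exp P (F t) X (M t).

Let sF t : 0 <= t <= 1 -> sigma_algebra setT (F t).
Proof. exact: Ft_sigma_algebra. Qed.
Let FM t : 0 <= t <= 1 -> F t `<=` measurable.
Proof. exact: Ft_measurable. Qed.

Let eps (k : nat) : R := 1 / (2 ^ k.+1)%:R.

Let eps0 k : 0 < eps k.
Proof. by rewrite divr_gt0// ltr0n expn_gt0. Qed.

(* The set of the t for which M_r is a good approximation of the limit of M_s as
   s decreases to t. Quantifying over all s in ]t, r] makes it order-convex in t,
   hence Borel, and only countably many r are needed to cover [0, 1[. *)
Definition fast_right_time k r : set R := [set t | [/\ 0 <= t, t < r <= 1, r <= t + eps k &
  forall s, t < s <= r -> (\int[P]_w `|M r w - M s w|%:E <= (eps k)%:E)%E]].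

Lemma measurable_fast_right_time k r : measurable (fast_right_time k r : set (measurableTypeR R)).
Proof.
apply: is_interval_measurable => a b [a0 /andP[ar r1] ra ha] [b0 /andP[br _] _ _] c.
move=> /andP[ac cb]; split.
- exact: le_trans a0 ac.
- by rewrite r1 (le_lt_trans cb).
- by rewrite (le_trans ra)// lerD2r.
- by move=> s /andP[cs sr]; apply: ha; rewrite (le_lt_trans ac).
Qed.

Definition nth_rat n : R := ratr (odflt 0 (unpickle n)).

(** If [r0] is good at precision [eps k / 2], then every time in []t, r0]] is good at precision
    [eps k], by comparison through [M r0]. This freedom allows a rational time, also close enough to
    [t]. *)
Lemma fast_right_time_cover k t : 0 <= t < 1 -> exists n, fast_right_time k (nth_rat n) t.
Proof.
move=> t01; have [/andP[t0 t1]] := t01.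
have e2 : 0 < eps k / 2 by rewrite divr_gt0.
have [r0 /andP[tr0 r01] hr0] := martingale_right_cauchy MX t01 e2.
have /rat_in_itvoo[q] : t < Num.min r0 (t + eps k) by rewrite lt_min tr0 ltrDl eps0.
rewrite in_itv/= lt_min => /and3P[tq qr0 qt].
exists (pickle q); rewrite /nth_rat pickleK/=; split => //.
- by rewrite tq (le_trans (ltW qr0)).
- exact: ltW.
move=> s /andP[ts sq].
have mM u : 0 <= u <= 1 -> measurable_fun setT (M u).
  by move=> u01; have [_ iM _ _] := MX u01; apply/measurable_EFinP; exact: measurable_int iM.
have qr0' : 0 <= r0 <= 1 by rewrite (le_trans t0 (ltW tr0)).
have q01 : 0 <= (ratr q : R) <= 1 by rewrite (le_trans t0 (ltW tq)) (le_trans (ltW qr0)).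
have s01 : 0 <= s <= 1 by rewrite (le_trans t0 (ltW ts)) (le_trans sq)//; case/andP: q01.
apply: (le_trans (L1_dist_triangle P (mM _ q01) (mM _ qr0') (mM _ s01))).
rewrite [eps k]splitr EFinD; apply: leeD.
  under eq_integral do rewrite distrC.
  by apply: hr0; rewrite tq ltW.
by apply: hr0; rewrite ts (le_trans sq (ltW qr0)).
Qed.

(** The [t] for which [n] is the first suitable index. These Borel sets are disjoint and
    [right_time k] is constant on each. *)
Let block k := seqDU (fun n => fast_right_time k (nth_rat n)).

Let measurable_block k n : measurable (block k n : set (measurableTypeR R)).
Proof. by apply: seqDU_measurable => m; exact: measurable_fast_right_time. Qed.

Definition right_time k t : R := nth_rat (xget 0%N [set n | block k n t]).

Let right_timeE k n t : block k n t -> right_time k t = nth_rat n.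
Proof.
move=> bn; congr nth_rat; apply: xget_unique => // m bm.
by apply: (@trivIset_seqDU _ (fun n => fast_right_time k (nth_rat n)) m n) => //; exists t.
Qed.

Let block_ex k t : 0 <= t < 1 -> exists n, block k n t.
Proof.
move=> /(fast_right_time_cover k)[m gm].
have : (\bigcup_n fast_right_time k (nth_rat n)) t by exists m.
by rewrite seqDU_bigcup_eq => -[n _ bn]; exists n.
Qed.

Lemma right_timeP k t : 0 <= t < 1 -> fast_right_time k (right_time k t) t.
Proof.
by move=> /(block_ex k)[n bn]; rewrite (right_timeE bn); exact: subset_seqDU bn.
Qed.

(** The limsup exists at every [w], so no null set, possibly outside [F t], has to be cut out;
    [fine] sends infinite values to 0. At 1 there is no later time to approximate from. *)
Definition prog_version t w : R :=
  if t < 1 then fine (limn_esup (fun k => (M (right_time k t) w)%:E)) else M 1 w.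

(** The value 0 for times beyond [T] keeps each term measurable for [F T]. *)
Let approx T k t w := if 0 <= right_time k t <= T then M (right_time k t) w else 0.

(* For t < T only the values of M at times at most T matter in the limit; this
   gives B(R) (x) F_T-measurability on [0, T[ x Omega, whereas taking the
   intersection of the B(R) (x) F_s over s > T could give a larger sigma-field. *)
Let versionE T t w : 0 <= t < T -> T <= 1 ->
  prog_version t w = fine (limn_esup (fun k => (approx T k t w)%:E)).
Proof.
move=> /andP[t0 tT] T1; have t1 := lt_le_trans tT T1.
rewrite /prog_version t1; congr fine; apply: limn_esup_near_eq.
have Tt : 0 < T - t by rewrite subr_gt0.
have [n _ hn] := near_infty_natSinv_expn_lt (PosNum Tt).
near=> k; rewrite /approx ifT//.
have [_ /andP[tr _] rt _] := right_timeP k (introT andP (conj t0 t1)).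
rewrite (le_trans t0 (ltW tr))/= (le_trans rt)// addrC -lerBrDr ltW//.
rewrite /eps natrX; apply: hn => /=; rewrite (@leq_trans k)//.
by near: k; exact: nbhs_infty_ge.
Unshelve. all: by end_near.
Qed.

Let approx_adapted T k t : 0 <= T <= 1 ->
  forall B, measurable B -> F T (approx T k t @^-1` B).
Proof.
move=> T01; have [T0 T1] := andP T01; apply/(measurable_fun_gT (sF T01)).
rewrite /approx; have [|] := boolP (0 <= right_time k t <= T); last first.
  by move=> _; exact: measurable_cst.
move=> /andP[r0 rT].
apply/(measurable_fun_gT (sF T01)) => B mB.
apply: (@Ft_nondecreasing _ _ _ F _ T r0 rT T1).
have r01 : 0 <= right_time k t <= 1 by rewrite r0 (le_trans rT).
by have [_ _ + _] := MX r01; exact.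
Qed.

Let version_adapted t : 0 <= t <= 1 ->
  forall B, measurable B -> F t (prog_version t @^-1` B).
Proof.
move=> /andP[t0]; rewrite le_eqVlt => /predU1P[-> |t1].
  rewrite (_ : prog_version 1 = M 1); last by apply/funext => w; rewrite /prog_version ltxx.
  have c01 : 0 <= (1 : R) <= 1 by rewrite ler01 lexx.
  by have [_ _ + _] := MX c01.
move=> B mB; have t01 : 0 <= t < 1 by rewrite t0.
(* By right continuity it suffices to prove measurability for each [F T] with [T > t], where the
   limsup can be taken along [approx T]. *)
rewrite (Ft_right_continuous _ t01) => T; rewrite /= in_itv/= => /andP[tT T1].
have T01 : 0 <= T <= 1 by rewrite (le_trans t0 (ltW tT)).
move: B mB; apply/(measurable_fun_gT (sF T01)).
rewrite (_ : prog_version t = fun w => fine (limn_esup (fun k => (approx T k t w)%:E))).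
  apply: measurableT_comp => //; apply: measurable_fun_limn_esup => k.
  by apply/measurable_EFinP/(measurable_fun_gT (sF T01)); exact: approx_adapted.
by apply/funext => w; apply: versionE => //; rewrite t0.
Qed.

(** On [[0, T[] the limsup is that of [approx T k], which is jointly measurable block by block; on
    the slice at [T], adaptedness at that one time is enough. *)
Lemma prog_version_BF : BF_measurable F (fun x => prog_version x.1 x.2).
Proof.
apply/BF_measurableP => T T01; have [T0 T1] := andP T01.
pose XT := (measurableTypeR R * g_sigma_algebraType (F T))%type.
rewrite (_ : `[0, T]%classic = `[0, T[%classic `|` [set T]); last first.
  by rewrite setUitv1.
have mlt : measurable (`[0, T[ `*` setT : set XT).
  by apply: measurableX => //; exact: measurable_itv.
have mT : measurable ([set T] `*` setT : set XT).
  by apply: measurableX => //; exact: measurable_set1.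
rewrite (_ : (_ `|` _) `*` _ = (`[0, T[ `*` setT) `|` ([set T] `*` setT) :> set XT); last first.
  apply/seteqP; split=> [[t w] [[] ? _]|[t w] [] []]; [by left|by right|..].
    by split=> //; left.
  by split=> //; right.
apply/measurable_funU => //; split.
  apply: (@eq_measurable_fun _ _ _ _ _
    (fun x : XT => fine (limn_esup (fun k => (approx T k x.1 x.2)%:E)))).
    move=> [t w] /set_mem[/= + _]; rewrite in_itv/= => ?.
    by rewrite -versionE.
  apply: (@measurableT_comp _ _ _ _ _ _ (@fine R)) => //; apply: measurable_fun_limn_esup => k.
  apply/measurable_EFinP.
  (* On each block the time is the constant [nth_rat n], so the process depends on [w] only. *)
  rewrite (_ : _ `*` _ = \bigcup_n ((block k n `&` `[0, T[) `*` setT)); last first.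
    apply/seteqP; split=> [[t w] [/= tT _]|[t w] [n _ [/= [bt tT] _]] //].
    have t01 : 0 <= t < 1 by move: tT; rewrite in_itv/= => /andP[-> /lt_le_trans]; exact.
    by have [n bn] := block_ex k t01; exists n.
  have mb n : measurable ((block k n `&` `[0, T[) `*` setT : set XT).
    apply: measurableX => //; apply: measurableI; first exact: measurable_block.
    exact: measurable_itv.
  apply/measurable_fun_bigcup => // n.
  pose c : R * Omega -> R := fun x => if 0 <= nth_rat n <= T then M (nth_rat n) x.2 else 0.
  apply: (@eq_measurable_fun _ _ _ _ _ (c : XT -> R)).
    by move=> [t w] /set_mem[/= [bt _] _]; rewrite /c /approx (right_timeE bt).
  apply: measurable_funTS; rewrite /c.
  have [/andP[r0 rT]|_] := boolP (0 <= nth_rat n <= T); last exact: measurable_cst.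
  have r01 : 0 <= nth_rat n <= 1 by rewrite r0 (le_trans rT).
  apply: (measurableT_comp _ (@measurable_snd _ _ (measurableTypeR R) (g_sigma_algebraType (F T)))).
  apply/(measurable_fun_gT (sF T01)) => B mB.
  apply: (@Ft_nondecreasing _ _ _ F _ T r0 rT T1).
  by have [_ _ + _] := MX r01; exact.
apply: (@eq_measurable_fun _ _ _ _ _ ((fun x : R * Omega => prog_version T x.2) : XT -> R)).
  by move=> [t w] /set_mem[/= -> _].
apply: measurable_funTS.
apply: (measurableT_comp _ (@measurable_snd _ _ (measurableTypeR R) (g_sigma_algebraType (F T)))).
by apply/(measurable_fun_gT (sF T01)); exact: version_adapted.
Qed.

Lemma prog_version_cond_exp t : 0 <= t <= 1 -> is_cond_exp P (F t) X (prog_version t).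
Proof.
move=> t01'; have c01 : 0 <= (1 : R) <= 1 by rewrite ler01 lexx.
have [t0] := andP t01'; rewrite le_eqVlt => /predU1P[-> |t1].
  rewrite (_ : prog_version 1 = M 1); first exact: MX.
  by apply/funext => w; rewrite /prog_version ltxx.
have t01 : 0 <= t < 1 by rewrite t0.
have r01 k : 0 <= right_time k t <= 1.
  by have [_ /andP[tr ->] _ _] := right_timeP k t01; rewrite (le_trans t0 (ltW tr)).
have ir k : P.-integrable setT (EFin \o M (right_time k t)) by have [] := MX (r01 k).
have fast k : (\int[P]_w `|M (right_time k.+1 t) w - M (right_time k t) w|%:E <= (eps k)%:E)%E.
  have [_ /andP[tr _] _ hr] := right_timeP k t01.
  have [_ /andP[tr' _] _ hr'] := right_timeP k.+1 t01.
  (* Successive times need not decrease; the later of the two supplies the estimate, and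
     [eps k.+1 <= eps k]. *)
  have [rr|rr] := leP (right_time k.+1 t) (right_time k t).
    by under eq_integral do rewrite distrC; apply: hr; rewrite tr'.
  apply: (@le_trans _ _ (eps k.+1)%:E); first by apply: hr'; rewrite tr ltW.
  rewrite lee_fin ler_pM2l// lef_pV2 ?posrE ?ltr0n ?expn_gt0// ler_nat.
  by rewrite leq_exp2l.
have [iZ cvgZ] := L1_fast_limit ir fast.
have [iX _ _ _] := MX c01.
have vE : prog_version t =
    fun w => fine (limn_esup (fun k => (M (right_time k t) w)%:E)).
  by apply/funext => w; rewrite /prog_version t1.
have mv := version_adapted t01'; rewrite vE in mv *; split => //.
move=> A FA; apply/esym; apply: cvg_unique (cvgZ A (FM t01' FA)) => //.
(* The times lie after [t], so [A] belongs to each of their sigma-fields and the sequence of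
   integrals is constant. *)
rewrite (_ : (fun k => _) = cst (\int[P]_(w in A) X w)); first exact: cvg_cst.
apply/funext => k; have [_ _ _ -> //] := MX (r01 k).
have [_ /andP[tr r1] _ _] := right_timeP k t01.
exact: (@Ft_nondecreasing _ _ _ F t _ t0 (ltW tr) r1).
Qed.

End progressive_version.

(** * Joint integrability on [[0, 1] x Omega] *)

Section joint.
Context {d : measure_display} {Omega : measurableType d} {R : realType}.
Variables (P : probability Omega R).
Local Notation mes := (@lebesgue_measure R).
Local Notation process := (R * Omega -> R)%type.
Local Notation XO := (measurableTypeR R * Omega)%type.
Local Notation D01 := (`[0, 1] `*` setT : set XO).
Local Notation nu := (mes \x P)%E.

Implicit Types f h : process.

(* As in_Lp, but without adaptedness. *)
Definition joint_Lp (q : R) (f : process) : Prop :=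
  measurable_fun (setT : set XO) (f \_ D01) /\
  (\int[P]_w \int[mes]_(t in `[0%R, 1%R]) (`|f (t, w)| `^ q)%:E < +oo)%E.

Lemma patch01E (T : Type) (z : T) (f : R * Omega -> T) s w :
  patch (fun=> z) D01 f (s, w) = patch (fun=> z) `[0, 1] (fun t => f (t, w)) s.
Proof. by rewrite /patch in_setX in_setT andbT. Qed.

Lemma patch01M (f h : process) : (f \* h) \_ D01 = (f \_ D01) \* (h \_ D01).
Proof. by apply/funext => x; rewrite /patch /=; case: ifPn; rewrite ?mulr0. Qed.

Lemma integral_patch01 (f : process) w :
  (\int[mes]_(s in `[0%R, 1%R]) (f (s, w))%:E = \int[mes]_s ((f \_ D01) (s, w))%:E)%E.
Proof.
rewrite integral_mkcond; apply: eq_integral => s _; rewrite patch01E /patch.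
by case: ifPn.
Qed.

Lemma in_Lp_joint F q f : 0 < q -> in_Lp P F q f -> joint_Lp q f.
Proof.
move=> q0 [mf foo]; split; first exact: BF_measurable_joint mf.
by move: foo; apply: lty_poweRy; rewrite gt_eqF// invr_gt0.
Qed.

Lemma joint_powR_patch q (f : process) : 0 < q ->
  (fun x => `|f x| `^ q) \_ D01 = (fun x => `|(f \_ D01) x| `^ q).
Proof.
move=> q0; apply/funext => x; rewrite /patch; case: ifPn => // _.
by rewrite normr0 powR0// gt_eqF.
Qed.

Lemma measurable_powR_patch q f : 0 < q ->
  measurable_fun (setT : set XO) (f \_ D01) ->
  measurable_fun (setT : set XO) ((fun x => `|f x| `^ q) \_ D01).
Proof.
move=> q0 mf; rewrite joint_powR_patch//.
apply: (@measurableT_comp _ _ _ _ _ _ (@powR R ^~ q)) => //.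
exact: measurableT_comp.
Qed.

Lemma joint_Lp_powR_integrable q f : 0 < q -> joint_Lp q f ->
  nu.-integrable setT (EFin \o ((fun x => `|f x| `^ q) \_ D01)).
Proof.
move=> q0 [mf foo]; have mp := measurable_powR_patch q0 mf.
have mpE : measurable_fun (setT : set XO) (EFin \o ((fun x => `|f x| `^ q) \_ D01)).
  exact/measurable_EFinP.
apply/(integrable21ltyP _ _ mpE); apply: le_lt_trans foo.
rewrite le_eqVlt; apply/orP; left; apply/eqP; apply: eq_integral => w _.
rewrite (integral_patch01 (fun x => `|f x| `^ q)); apply: eq_integral => s _ /=.
rewrite ger0_norm// /patch; case: ifPn => // _; exact: powR_ge0.
Qed.

(** Young's inequality dominates the product by a combination of the two integrable powers. *)
Lemma joint_mul_integrable (p q : R) f h : 0 < p -> 0 < q -> p^-1 + q^-1 = 1 ->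
    joint_Lp p f -> joint_Lp q h ->
  nu.-integrable setT (EFin \o ((f \* h) \_ D01)).
Proof.
move=> p0 q0 pq Jf Jh; have [mf _] := Jf; have [mh _] := Jh.
have if_ := integrableZl measurableT p^-1 (joint_Lp_powR_integrable p0 Jf).
have ih_ := integrableZl measurableT q^-1 (joint_Lp_powR_integrable q0 Jh).
apply: le_integrable (integrableD measurableT if_ ih_) => //.
  by apply/measurable_EFinP; rewrite patch01M; exact: measurable_funM.
move=> x _; rewrite !joint_powR_patch// patch01M /= lee_fin normrM.
rewrite [leRHS]ger0_norm; last by rewrite addr_ge0// mulr_ge0 ?powR_ge0// invr_ge0 ltW.
by rewrite ![_^-1 * _]mulrC; exact: conjugate_powR.
Qed.

Lemma joint_Lp_integrable q f : 1 < q -> joint_Lp q f ->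
  nu.-integrable setT (EFin \o (f \_ D01)).
Proof.
move=> q1 Jf; have q0 := lt_trans ltr01 q1.
have p0 : 0 < q / (q - 1) by rewrite divr_gt0// subr_gt0.
have pq : q^-1 + (q / (q - 1))^-1 = 1.
  by rewrite invf_div mulrBl divff ?gt_eqF// mul1r addrC subrK.
(* The constant 1 serves as second factor: [[0, 1] x Omega] has measure 1. *)
have J1 : joint_Lp (q / (q - 1)) (cst 1).
  split.
    rewrite (_ : _ \_ _ = (\1_D01 : process)); last first.
      by apply/funext => x; rewrite /patch indicE; case: ifPn.
    by apply: measurable_indic; apply: measurableX => //; exact: measurable_itv.
  have mI1 : mes [set` `[0, 1]] = 1%E by rewrite lebesgue_measure_itv/= lte01 sube0.
  rewrite /= normr1 powR1.
  under eq_integral do rewrite integral_cst//= [X in (_ * X)%E]mI1.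
  by rewrite mule1 integral_cst// mul1e [X in (X < _)%E]probability_setT ltry.
apply: eq_integrable (joint_mul_integrable q0 p0 pq Jf J1) => // x _ /=.
by rewrite /patch /= mulr1.
Qed.

(** Putting time outside makes conditional expectations given [F u] applicable to the inner
    integral. *)
Lemma pairingE f h : nu.-integrable setT (EFin \o ((f \* h) \_ D01)) ->
  (pairing P f h)%:E = (\int[mes]_u \int[P]_w (((f \* h) \_ D01) (u, w))%:E)%E.
Proof.
move=> ifh; rewrite (Fubini ifh).
have iG := integrable_fubini_G ifh.
have [ifG fG] := integrable_fine iG.
rewrite -[RHS]fG -[RHS]fineK; last exact: integrable_fin_num ifG.
rewrite /pairing /Rintegral; congr (fine _)%:E; apply: eq_integral => w _.
by rewrite (integral_patch01 (f \* h)).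
Qed.

(** Joint measurability on [[0, t] x Omega] passes to the section at the endpoint [t]. *)
Lemma BF_adapted F f t : BF_measurable F f -> 0 <= t <= 1 ->
  forall B, measurable B -> F t ((fun w => f (t, w)) @^-1` B).
Proof.
move=> /BF_measurableP mf t01; have [t0 t1] := andP t01.
apply/(measurable_fun_gT (Ft_sigma_algebra F t01)).
pose D : set (measurableTypeR R * g_sigma_algebraType (F t)) := `[0, t] `*` setT.
have mD : measurable D by apply: measurableX => //; exact: measurable_itv.
have := mf t t01; rewrite (measurable_restrictT _ mD) => mfD.
have := @measurable_fun_pair2 _ _ _ _ _ _ _ t mfD.
apply: eq_measurable_fun => w _.
by rewrite /patch mem_set//; split => //=; rewrite in_itv/= t0 lexx.
Qed.

Lemma BF_measurableB F f h : BF_measurable F f -> BF_measurable F h ->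
  BF_measurable F (f \- h).
Proof.
move=> /BF_measurableP mf /BF_measurableP mh; apply/BF_measurableP => t t01.
by apply: measurable_funB; [exact: mf|exact: mh].
Qed.

Lemma ae_section_integrable q f : 1 < q -> joint_Lp q f ->
  {ae P, forall w, mes.-integrable `[0, 1] (EFin \o (fun s => f (s, w)))}.
Proof.
move=> q1 Jf.
apply: filterS (ae_integrable2 (joint_Lp_integrable q1 Jf)) => w iw.
rewrite integrable_mkcond; last exact: measurable_itv.
apply: eq_integrable iw => // s _ /=; rewrite patch01E /patch.
by case: ifPn.
Qed.

(* Only almost surely: where f(., w) is not integrable, Rintegral takes junk
   values. *)
Lemma ae_int0 q f : 1 < q -> joint_Lp q f -> {ae P, forall w, forall t, 0 <= t <= 1 ->
  \int[mes]_(s in `[0, 1]) f (s, w) - int0 f (t, w) = \int[mes]_(s in `[t, 1]) f (s, w)}.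
Proof.
move=> q1 Jf.
apply: filterS (ae_section_integrable q1 Jf) => w i01 t /andP[t0 t1].
rewrite /int0 /= Rintegral_itvB ?bnd_simp// Rintegral_itv_obnd_cbnd//.
apply: integrableS i01 => //.
by apply: subset_itvr; rewrite bnd_simp.
Qed.

End joint.

(** * Existence, integrability and pairings of selections *)

Section selections.
Context {d : measure_display} {Omega : measurableType d} {R : realType}.
Variables (P : probability Omega R) (F : filtration Omega R).
Local Notation mes := (@lebesgue_measure R).
Local Notation process := (R * Omega -> R)%type.
Local Notation XO := (measurableTypeR R * Omega)%type.
Local Notation D01 := (`[0, 1] `*` setT : set XO).
Local Notation nu := (mes \x P)%E.
Implicit Types f h : process.

Lemma integrable_Rintegral_section q f (A : set (measurableTypeR R)) : 1 < q ->
    joint_Lp P q f -> measurable A -> A `<=` `[0, 1] ->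
  P.-integrable setT (EFin \o (fun w => \int[mes]_(s in A) f (s, w))).
Proof.
move=> q1 Jf mA A01.
have mAT : measurable (A `*` setT : set XO) by exact: measurableX.
have iA : nu.-integrable setT ((EFin \o (f \_ D01)) \_ (A `*` setT)).
  apply/(integrable_mkcond _ mAT).
  by apply: integrableS (joint_Lp_integrable q1 Jf).
have [+ _] := integrable_fine (integrable_fubini_G iA).
apply: eq_integrable => // w _ /=; congr (fine _)%:E.
rewrite [RHS]integral_mkcond; apply: eq_integral => s _.
rewrite /patch !in_setX !in_setT !andbT.
by case: ifPn => // /set_mem/A01 sI; rewrite /= mem_set.
Qed.

(** Apart from integrability, [X] enters only through integrals over sets of [G], which do not see
    null sets. [Y] is left unchanged, since altering it on a null set could spoil its
    [G]-measurability. *)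
Lemma cond_exp_ae (G : set (set Omega)) (X X' Y : Omega -> R) : G `<=` measurable ->
    is_cond_exp P G X Y -> P.-integrable setT (EFin \o X') ->
    {ae P, forall w, X w = X' w} ->
  is_cond_exp P G X' Y.
Proof.
move=> GM [iX iY mY XY] iX' XX'; split => // A GA; rewrite XY//; congr fine.
apply: ae_eq_integral; first exact: GM.
- by apply: measurable_funTS; exact: measurable_int iX.
- by apply: measurable_funTS; exact: measurable_int iX'.
- by apply: filterS XX' => w /= ->.
Qed.

(* A jointly measurable version of the tail integral, cf. [ae_int0]. *)
Let tail f : process := fun x => \int[mes]_(s in `[0, 1]) f (s, x.2) - int0 f x.

Let tail_cond_exp q f Y t : 1 < q -> in_Lp P F q f -> 0 <= t <= 1 ->
  is_cond_exp P (F t) (fun w => \int[mes]_(s in `[0, 1]) f (s, w)) Y ->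
  is_cond_exp P (F t) (fun w => tail f (t, w)) (fun w => Y w - int0 f (t, w)).
Proof.
move=> q1 Lf t01 XY; have q0 := lt_trans ltr01 q1.
have Jf := in_Lp_joint q0 Lf; have [mf _] := Lf.
have i0 : P.-integrable setT (EFin \o (fun w => int0 f (t, w))).
  rewrite /int0 /=; apply: (integrable_Rintegral_section q1 Jf) => //.
  by apply: subset_itvl; rewrite bnd_simp; case/andP: t01.
(* Being adapted, [int0 f] at time [t] is its own conditional expectation. *)
have c0 : is_cond_exp P (F t) (fun w => int0 f (t, w)) (fun w => int0 f (t, w)).
  by split; [exact: i0|exact: i0|exact: (BF_adapted (int0_BF mf) t01)|].
exact: (cond_expB (Ft_sigma_algebra F t01) (@Ft_measurable _ _ _ F t t01) XY c0).
Qed.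

Lemma selection_exists q f : 1 < q -> in_Lp P F q f ->
  exists g, BF_measurable F g /\ is_selection P F f g.
Proof.
move=> q1 Lf; have q0 := lt_trans ltr01 q1.
have Jf := in_Lp_joint q0 Lf; have [mf _] := Lf.
pose X w := \int[mes]_(s in `[0, 1]) f (s, w).
have iX : P.-integrable setT (EFin \o X).
  exact: (integrable_Rintegral_section q1 Jf).
have /choice [M MX] : forall t, exists M, 0 <= t <= 1 -> is_cond_exp P (F t) X M.
  move=> t; have [t01|] := boolP (0 <= t <= 1); last by exists (cst 0).
  have [M ?] := cond_exp_exists (Ft_sigma_algebra F t01) (@Ft_measurable _ _ _ F t t01) iX.
  by exists M.
exists (fun x => prog_version P M x.1 x.2 - int0 f x); split.
  by apply: BF_measurableB; [exact: prog_version_BF MX|exact: int0_BF].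
move=> t t01.
apply: (cond_exp_ae (@Ft_measurable _ _ _ F t t01)
  (tail_cond_exp q1 Lf t01 (prog_version_cond_exp MX t01))).
  apply: (integrable_Rintegral_section q1 Jf) => //.
  by apply: subset_itvr; rewrite bnd_simp; case/andP: t01.
by apply: filterS (ae_int0 q1 Jf) => w; exact.
Qed.

Lemma joint_Lp_bounded q h (B : Omega -> \bar R) :
    measurable_fun (setT : set XO) (h \_ D01) -> (forall w, 0 <= B w)%E ->
    (\int[P]_w B w < +oo)%E ->
    (forall u w, 0 <= u <= 1 -> ((`|h (u, w)| `^ q)%:E <= B w)%E) ->
  joint_Lp P q h.
Proof.
move=> mh B0 Boo hB; split => //; apply: le_lt_trans Boo.
apply: le_integral_nomeas => w.
  by apply: integral_ge0 => u _; rewrite lee_fin powR_ge0.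
have mI1 : mes [set` `[0, 1]] = 1%E by rewrite lebesgue_measure_itv/= lte01 sube0.
apply: (@le_trans _ _ (\int[mes]_(u in `[0%R, 1%R]) B w)%E); last first.
  by rewrite integral_cst//= [X in (_ * X)%E]mI1 mule1.
rewrite integral_mkcond [leRHS]integral_mkcond; apply: le_integral_nomeas => u.
  by rewrite /patch; case: ifPn => // _; rewrite lee_fin powR_ge0.
rewrite /patch; case: ifPn => // /set_mem; rewrite /= in_itv/= => u01.
exact: hB.
Qed.

(** The bound is infinite where [|f|^q] is not integrable in time. Elsewhere the tail is an integral
    over []u, 1]], and Hölder's inequality on [[0, 1]] applies; hence the bound holds at every
    [w]. *)
Let tail_powR_le q f u w : 1 < q -> BF_measurable F f -> 0 <= u <= 1 ->
  ((`|tail f (u, w)| `^ q)%:E <= \int[mes]_(s in `[0%R, 1%R]) (`|f (s, w)| `^ q)%:E)%E.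
Proof.
move=> q1 mf /andP[u0 u1].
have q0 : 0 <= q by rewrite (le_trans _ (ltW q1)).
have [foo|] := ltP (\int[mes]_(s in `[0%R, 1%R]) (`|f (s, w)| `^ q)%:E)%E +oo%E;
  last by rewrite leye_eq => /eqP ->; rewrite leey.
apply: le_trans (powR_integral_le q1 (section_measurable w mf)).
have intf := section_integrable q1 mf foo.
rewrite -poweR_EFin; apply: gt0_ler_poweR => //.
- by rewrite in_itv/= lee_fin normr_ge0 leey.
- rewrite in_itv/= leey andbT; apply: integral_ge0 => s _.
  by rewrite lee_fin.
have intu : mes.-integrable `]u, 1] (EFin \o (fun s => f (s, w))).
  by apply: integrableS intf => //; apply: subset_itvr; rewrite bnd_simp.
rewrite /tail /int0/= Rintegral_itvB ?bnd_simp// (EFin_normr_Rintegral _ intu)//.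
apply: le_trans (le_abse_integral _ _ _) _ => //; first by case/integrableP: intu.
apply: ge0_subset_integral => //; last by apply: subset_itvr; rewrite bnd_simp.
by case/integrableP: intf => + _; exact: measurableT_comp.
Qed.

(** Passes from the integral over [[u, 1]] to its almost sure version [tail f], for which joint
    measurability and [tail_powR_le] are available. *)
Let tail_selection q f g u : 1 < q -> in_Lp P F q f -> is_selection P F f g ->
  0 <= u <= 1 -> is_cond_exp P (F u) (fun w => tail f (u, w)) (fun w => g (u, w)).
Proof.
move=> q1 Lf gP u01; have q0 := lt_trans ltr01 q1.
have Jf := in_Lp_joint q0 Lf.
apply: (cond_exp_ae (@Ft_measurable _ _ _ F u u01) (gP u u01)).
  have i01 : P.-integrable setT (EFin \o (fun w => \int[mes]_(s in `[0, 1]) f (s, w))).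
    exact: (integrable_Rintegral_section q1 Jf).
  have i0 : P.-integrable setT (EFin \o (fun w => int0 f (u, w))).
    rewrite /int0 /=; apply: (integrable_Rintegral_section q1 Jf) => //.
    by apply: subset_itvl; rewrite bnd_simp; case/andP: u01.
  exact: (integrable_EFinB i01 i0).
by apply: filterS (ae_int0 q1 Jf) => w /(_ u u01); exact: esym.
Qed.

Lemma selection_joint_Lp q f g : 1 < q -> in_Lp P F q f -> BF_measurable F g ->
  is_selection P F f g -> joint_Lp P q g.
Proof.
move=> q1 Lf mg gP; have q0 := lt_trans ltr01 q1.
have [_ Boo] := in_Lp_joint q0 Lf; have [mf _] := Lf.
have mg' := BF_measurable_joint mg.
split; first exact: mg'.
apply: le_lt_trans Boo; set C := (leRHS).
have C0 : (0 <= C)%E.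
  by apply: integral_ge0 => w _; apply: integral_ge0 => s _; rewrite lee_fin powR_ge0.
have mp : measurable_fun (setT : set XO) (EFin \o ((fun x => `|g x| `^ q) \_ D01)).
  by apply/measurable_EFinP; exact: measurable_powR_patch.
have p_ge0 (x : XO) : (0 <= (EFin \o ((fun x => (`|g x| `^ q)%R) \_ D01)) x)%E.
  by rewrite /= lee_fin /patch; case: ifPn => // _; exact: powR_ge0.
under eq_integral do rewrite (integral_patch01 (fun x => `|g x| `^ q)).
(* Moments are compared for one [u] at a time, so time goes outside; the bound [C] does not depend
   on [u]. *)
rewrite -(@fubini_tonelli _ _ _ _ _ mes P _ mp p_ge0).
have mI1 : mes [set` `[0, 1]] = 1%E by rewrite lebesgue_measure_itv/= lte01 sube0.
apply: (@le_trans _ _ (\int[mes]_(u in `[0%R, 1%R]) C)%E); last first.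
  by rewrite integral_cst//= [X in (_ * X)%E]mI1 mule1.
rewrite [leRHS]integral_mkcond; apply: le_integral_nomeas => u.
  by apply: integral_ge0 => w _; exact: p_ge0.
rewrite [in leRHS]/patch; case: ifPn => [/set_mem|uN].
  rewrite /= in_itv/= => u01.
  have TG := tail_selection q1 Lf gP u01.
  have := cond_exp_powR_le (Ft_sigma_algebra F u01) (@Ft_measurable _ _ _ F u u01) q1 TG.
  move=> h; apply: le_trans (le_trans _ h) _.
    by apply: le_integral_nomeas => w //; rewrite patch01E /patch mem_set//= in_itv.
  apply: le_integral_nomeas => w; first by rewrite lee_fin powR_ge0.
  exact: tail_powR_le.
rewrite integral0_eq// => w _.
by rewrite /= patch01E /patch (negbTE uN).
Qed.

Let tail_joint_Lp q f : 1 < q -> in_Lp P F q f -> joint_Lp P q (tail f).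
Proof.
move=> q1 Lf; have q0 := lt_trans ltr01 q1.
have Jf := in_Lp_joint q0 Lf; have [mf _] := Lf; have [_ Boo] := Jf.
have mD : measurable D01 by apply: measurableX => //; exact: measurable_itv.
apply: (joint_Lp_bounded _ _ Boo).
- have m0 := BF_measurable_joint (int0_BF mf).
  move/(measurable_restrictT _ mD): m0 => m0; apply/(measurable_restrictT _ mD).
  apply: measurable_funB; last exact: m0.
  apply: measurable_funTS.
  have iX : P.-integrable setT (EFin \o (fun w => \int[mes]_(s in `[0, 1]) f (s, w))).
    exact: (integrable_Rintegral_section q1 Jf).
  have /measurable_EFinP mX := measurable_int _ iX.
  exact: (measurableT_comp mX (@measurable_snd _ _ (measurableTypeR R) Omega)).
- by move=> w; apply: integral_ge0 => s _; rewrite lee_fin powR_ge0.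
- by move=> u w u01; exact: tail_powR_le.
Qed.

Let int0_joint_Lp p h : 1 < p -> in_Lp P F p h -> joint_Lp P p (int0 h).
Proof.
move=> p1 Lh; have p0 := lt_trans ltr01 p1.
have Jh := in_Lp_joint p0 Lh; have [mh _] := Lh; have [_ Boo] := Jh.
apply: (joint_Lp_bounded _ _ Boo).
- exact: BF_measurable_joint (int0_BF mh).
- by move=> w; apply: integral_ge0 => s _; rewrite lee_fin powR_ge0.
- by move=> u w u01; exact: (int0_powR_le w p1 mh u01).
Qed.

Lemma integrable_pairing f h : nu.-integrable setT (EFin \o ((f \* h) \_ D01)) ->
  P.-integrable setT (EFin \o (fun w => \int[mes]_(s in `[0, 1]) (f (s, w) * h (s, w)))).
Proof.
move=> ifh; have [+ _] := integrable_fine (integrable_fubini_G ifh).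
apply: eq_integrable => // w _ /=.
by rewrite /Rintegral (integral_patch01 (f \* h)).
Qed.

Let pairing_int0 p q f h : 1 < q -> 1 < p -> q^-1 + p^-1 = 1 ->
  in_Lp P F q f -> in_Lp P F p h -> pairing P f (int0 h) = pairing P (tail f) h.
Proof.
move=> q1 p1 qp Lf Lh.
have q0 := lt_trans ltr01 q1; have p0 := lt_trans ltr01 p1.
have Jf := in_Lp_joint q0 Lf; have Jh := in_Lp_joint p0 Lh.
have i1 := joint_mul_integrable q0 p0 qp Jf (int0_joint_Lp p1 Lh).
have i2 := joint_mul_integrable q0 p0 qp (tail_joint_Lp q1 Lf) Jh.
rewrite /pairing {1}/Rintegral [RHS]/Rintegral; congr fine.
apply: ae_eq_integral; first exact: measurableT.
- exact: measurable_int (integrable_pairing i1).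
- exact: measurable_int (integrable_pairing i2).
(* The triangle formula is applied path by path, where both sections are integrable in time. *)
apply: filterS3 (ae_int0 q1 Jf) (ae_section_integrable q1 Jf) (ae_section_integrable p1 Jh).
move=> w tE if_ ih _; congr EFin.
rewrite (Rintegral_mul_Rintegral_itv if_ ih).
apply: eq_Rintegral => u /set_mem; rewrite /= in_itv/= => u01.
by rewrite -(tE u u01).
Qed.

Lemma selection_pairing p q f g h : 1 < q -> 1 < p -> q^-1 + p^-1 = 1 ->
    in_Lp P F q f -> BF_measurable F g -> is_selection P F f g ->
    in_Lp P F p h ->
  pairing P g h = pairing P f (int0 h).
Proof.
move=> q1 p1 qp Lf mg gP Lh.
have q0 := lt_trans ltr01 q1; have p0 := lt_trans ltr01 p1.
have Jh := in_Lp_joint p0 Lh; have [mh _] := Lh.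
have i1 := joint_mul_integrable q0 p0 qp (selection_joint_Lp q1 Lf mg gP) Jh.
have i2 := joint_mul_integrable q0 p0 qp (tail_joint_Lp q1 Lf) Jh.
rewrite (pairing_int0 q1 p1 qp Lf Lh); apply: EFin_inj.
rewrite (pairingE i1) (pairingE i2).
apply: ae_eq_integral; first exact: measurableT.
- exact: measurable_fubini_F i1.
- exact: measurable_fubini_F i2.
(* For almost every [u] both products are integrable over [Omega], as [cond_exp_mul] with
   [U = h (u, .)] requires; outside [[0, 1]] both integrands vanish. *)
apply: filterS2 (ae_integrable1 i1) (ae_integrable1 i2) => u iu1 iu2 _.
have [|u01] := boolP (u \in `[0, 1]%classic); last first.
  by transitivity (0%E : \bar R); [|symmetry]; apply: integral0_eq => w _;
    rewrite /= patch01E /patch (negbTE u01).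
move=> uI; have u01 : 0 <= u <= 1 by move/set_mem: uI; rewrite /= in_itv.
have E (k : process) : (fun w => (((k \* h) \_ D01) (u, w))%:E) =
    (fun w => (h (u, w) * k (u, w))%:E).
  by apply/funext => w; rewrite patch01E /patch uI mulrC.
rewrite !E in iu1 iu2 *.
exact: (cond_exp_mul (Ft_sigma_algebra F u01) (@Ft_measurable _ _ _ F u u01)
  (tail_selection q1 Lf gP u01) (BF_adapted mh u01) iu2 iu1).
Qed.

End selections.

(** * Identification of the class [Lstar] through selections *)

Theorem theorem8 (R : realType) (d : measure_display) (Omega : measurableType d)
    (P : probability Omega R) (hP : measure_is_complete P)
    (F : filtration Omega R) (p : R) (p1 : 1 < p)
    (f : Lp P F (p / (p - 1))) :
  (exists g : R * Omega -> R,
      BF_measurable F g /\ is_selection P F (sval f) g) /\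
  (forall g : R * Omega -> R,
      BF_measurable F g -> is_selection P F (sval f) g -> Lstar p1 f g).
Proof.
have Lf := svalP f; have p0 : 0 < p := lt_trans ltr01 p1.
have q1 : 1 < p / (p - 1) by rewrite ltr_pdivlMr ?subr_gt0// mul1r ltrBlDr ltrDl.
have q0 : 0 < p / (p - 1) := lt_trans ltr01 q1.
have qp : (p / (p - 1))^-1 + p^-1 = 1.
  by rewrite invf_div mulrBl divff ?gt_eqF// mul1r subrK.
split; first exact: (selection_exists q1 Lf).
move=> g mg gP; split.
  (* The norm is a power of the integral whose finiteness [joint_Lp] records. *)
  split=> //; apply: poweR_lty.
  by have [_] := selection_joint_Lp q1 Lf mg gP.
by move=> phi; exact: (selection_pairing q1 p1 qp Lf mg gP (svalP phi)).
Qed.
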